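(* (Schwarz reflection principle for closed operators.) Let $\mathcal H_1,\mathcal H_2$ be complex Banach spaces, $\Theta\subset\mathbb C$ open, $z_0\in\Theta$, and let $\Theta\ni z\mapsto T_z\in\mathcal C_{\rm com}(\mathcal H_1,\mathcal H_2)$ have values in densely defined operators. Then $z\mapsto T_z$ is complex differentiable at $z_0$ if and only if the function $z\mapsto T_{\bar z}^*\in\mathcal C_{\rm com}(\mathcal H_2^*,\mathcal H_1^* )$ (defined on $\{z:\bar z\in\Theta\}$) is complex differentiable at $\bar z_0$.
   Context: $\mathcal C(\mathcal H_1,\mathcal H_2)$ denotes closed operators from (a linear subspace of) $\mathcal H_1$ to $\mathcal H_2$; $\mathcal C_{\rm com}(\mathcal H_1,\mathcal H_2)$ denotes those whose graph $\mathrm{Gr}(T)\subset\mathcal H_1\oplus\mathcal H_2$ possesses a closed complementary subspace. $\mathcal H^*$ denotes the antidual of $\mathcal H$, i.e. the Banach space of continuous anti-linear functionals on $\mathcal H$; the adjoint $T^*\in\mathcal C(\mathcal H_2^*,\mathcal H_1^* )$ of a densely defined $T\in\mathcal C(\mathcal H_1,\mathcal H_2)$ is taken with respect to this convention (so $(\lambda T)^*=\bar\lambda T^*$). For a complex Banach space $\mathcal H$, a function $z\mapsto\mathcal X_z$ from an open subset $\Theta$ of $\mathbb C$ to closed subspaces of $\mathcal H$ is complex differentiable at $z_0$ if there exist an open $\Theta_0$ with $z_0\in\Theta_0\subset\Theta$, a Banach space $\mathcal K$ and bounded injective operators with closed range $R_z:\mathcal K\to\mathcal H$, $z\in\Theta_0$,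 such that $R_z$ is a bijection of $\mathcal K$ onto $\mathcal X_z$ for all $z\in\Theta_0$ and $z\mapsto R_z$ is complex differentiable at $z_0$ in operator norm. A function $z\mapsto T_z\in\mathcal C(\mathcal H_1,\mathcal H_2)$ is complex differentiable at $z_0$ if $z\mapsto \mathrm{Gr}(T_z)$ is complex differentiable at $z_0$ as a function with values in closed subspaces of $\mathcal H_1\oplus\mathcal H_2$. *)

(* Defs.v *)
From HB Require Import structures.
From mathcomp Require Import all_boot all_order all_algebra.
From mathcomp Require Import all_classical all_reals all_analysis.
From mathcomp.real_closed Require Import complex.

Set Implicit Arguments.
Unset Strict Implicit.
Unset Printing Implicit Defensive.

Import Order.TTheory GRing.Theory Num.Theory.
Import numFieldNormedType.Exports.

Local Open Scope classical_set_scope.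
Local Open Scope ring_scope.

(* [anti = false] gives linear maps, [anti = true] antilinear maps. *)
Definition twist (R : realType) (anti : bool) (a : R[i]) : R[i] :=
  if anti then a^* else a.

Definition semilinear (R : realType) (anti : bool) (V W : normedModType R[i])
    (f : V -> W) : Prop :=
  forall (a : R[i]) (x y : V), f (a *: x + y) = twist anti a *: f x + f y.

Section BoundedOperators.
Context (R : realType) (anti : bool) (V W : normedModType R[i]).

Definition bounded_map_pred : {pred V -> W} :=
  [pred f : V -> W | `[< semilinear anti f /\ continuous f >]].

Record bounded_map := BoundedMap {
  bmap_fun :> V -> W ;
  bmap_funP : bmap_fun \in bounded_map_pred }.

HB.instance Definition _ := [isSub for bmap_fun].
HB.instance Definition _ := [Choice of bounded_map by <:].

Lemma normr_twist (a : R[i]) : `|twist anti a| = `|a|.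
Proof. by rewrite /twist; case: anti; rewrite ?norm_conjC. Qed.

Lemma bounded_map_predP (f : V -> W) :
  reflect (semilinear anti f /\ continuous f) (f \in bounded_map_pred).
Proof. exact: asboolP. Qed.

Lemma bounded_map_submod_closed : submod_closed bounded_map_pred.
Proof.
split.
  apply/bounded_map_predP; split; last exact: cst_continuous.
  by move=> a x y /=; rewrite scaler0 addr0.
move=> c f g /bounded_map_predP[lf cf] /bounded_map_predP[lg cg].
apply/bounded_map_predP; split=> [a x y|x].
  rewrite [LHS]/(c *: f (a *: x + y) + g (a *: x + y)) lf lg.
  rewrite [RHS]/(twist anti a *: (c *: f x + g x) + (c *: f y + g y)).
  rewrite !scalerDr !scalerA.
  by rewrite [c * _]mulrC; exact: addrACA.
apply: (@cvgD _ _ _ _ _ (fun x => c *: f x) g); last exact: cg.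
by apply: cvgZr; exact: cf.
Qed.

HB.instance Definition _ :=
  GRing.isSubmodClosed.Build R[i] (V -> W) bounded_map_pred
    bounded_map_submod_closed.
HB.instance Definition _ := [SubChoice_isSubLmodule of bounded_map by <:].

Implicit Types f g : bounded_map.

Lemma bounded_map_semilinear f : semilinear anti f.
Proof. by have /bounded_map_predP[] := bmap_funP f. Qed.

Lemma bounded_map_continuous f : continuous f.
Proof. by have /bounded_map_predP[] := bmap_funP f. Qed.

Lemma bounded_map0 f : f 0 = 0.
Proof.
have := bounded_map_semilinear f 1 0 0; rewrite scaler0 addr0 => /eqP.
rewrite -subr_eq0 opprD addrCA subrr addr0 oppr_eq0 scaler_eq0.
case/orP=> /eqP // /(congr1 Num.norm); rewrite normr_twist normr1 normr0.
by move/eqP; rewrite oner_eq0.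
Qed.

Lemma bounded_mapZ f a x : f (a *: x) = twist anti a *: f x.
Proof. by rewrite -[a *: x]addr0 bounded_map_semilinear bounded_map0 addr0. Qed.

Lemma normr_ReK (N : normedModType R[i]) (x : N) :
  (complex.Re `|x|)%:C%C = `|x|.
Proof. by apply: RRe_real; rewrite ger0_real. Qed.

(* Over R[i], norms take values in R[i]; these values are nonnegative reals,
   so that [complex.Re] loses no information on them. *)
Definition unit_ball_values f : set R :=
  [set complex.Re `|f x| | x in [set x : V | `|x| <= 1]].

Definition opnorm f : R[i] := (sup (unit_ball_values f))%:C%C.

Lemma unit_ball_values_has_sup f : has_sup (unit_ball_values f).
Proof.
split.
  by exists (complex.Re `|f 0|); exists 0 => //=; rewrite normr0.
have /cvgr0_norm_le : f x @[x --> (0 : V)] --> (0 : W).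
  by rewrite -[X in _ --> X](bounded_map0 f); exact: bounded_map_continuous.
move=> /(_ 1 ltr01) /nbhs_norm0P [e /= e0 fe].
have e2 : (0 : R[i]) < e / 2 by rewrite divr_gt0.
have e2n : `|e / 2| = e / 2 by rewrite gtr0_norm.
exists (complex.Re (e / 2)^-1) => _ [x /= x1 <-].
have le1 : `|f x| <= (e / 2)^-1.
  have : `|f ((e / 2) *: x)| <= 1.
    apply: fe => /=; rewrite normrZ e2n.
    rewrite (@le_lt_trans _ _ (e / 2)) ?ler_piMr ?(ltW e2)//.
    by rewrite ltr_pdivrMr// ltr_pMr// ltr1n.
  by rewrite bounded_mapZ normrZ normr_twist e2n -ler_pdivlMl// mulr1.
by move: le1; rewrite lecE => /andP[].
Qed.

Lemma opnorm_ub f x : `|x| <= 1 -> `|f x| <= opnorm f.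
Proof.
move=> x1; rewrite -normr_ReK /opnorm lecR.
by apply: ub_le_sup; [case: (unit_ball_values_has_sup f)|exists x].
Qed.

Lemma opnorm_le f (M : R) :
  (forall x, `|x| <= 1 -> `|f x| <= M%:C%C) -> opnorm f <= M%:C%C.
Proof.
move=> fM; rewrite /opnorm lecR; apply: ge_sup.
  by case: (unit_ball_values_has_sup f).
by move=> _ [x /= x1 <-]; rewrite -lecR normr_ReK fM.
Qed.

Lemma opnorm_real f : opnorm f = (complex.Re (opnorm f))%:C%C.
Proof. by []. Qed.

Lemma opnormD f g : opnorm (f + g) <= opnorm f + opnorm g.
Proof.
rewrite [leRHS](_ : _ = (complex.Re (opnorm f) + complex.Re (opnorm g))%:C%C).
  by apply: opnorm_le => x x1; rewrite rmorphD/= (le_trans (ler_normD _ _))//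
     lerD// opnorm_ub.
by rewrite rmorphD.
Qed.

Lemma opnormZ_le (c : R[i]) f : opnorm (c *: f) <= `|c| * opnorm f.
Proof.
have cE : `|c| = (complex.Re `|c|)%:C%C by rewrite RRe_real ?ger0_real.
have -> : `|c| * opnorm f = (complex.Re `|c| * complex.Re (opnorm f))%:C%C.
  by rewrite rmorphM/= -cE.
apply: opnorm_le => x x1; rewrite rmorphM/= -cE.
by rewrite [X in `|X|](_ : _ = c *: f x)// normrZ ler_wpM2l// opnorm_ub.
Qed.

Lemma opnormZ (c : R[i]) f : opnorm (c *: f) = `|c| * opnorm f.
Proof.
apply/eqP; rewrite eq_le opnormZ_le/=; have [->|c0] := eqVneq c 0.
  rewrite normr0 mul0r; apply: le_trans (opnorm_ub _ (x := 0) _) => //.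
  by rewrite normr0.
rewrite -ler_pdivlMl ?normr_gt0// -normfV.
by rewrite -[X in opnorm X <= _](scalerK c0) opnormZ_le.
Qed.

Lemma opnorm0_eq0 f : opnorm f = 0 -> f = 0.
Proof.
move=> f0; apply: val_inj; apply/funext => x.
suff : f x = 0 by [].
apply/eqP; rewrite -normr_eq0 eq_le normr_ge0 andbT.
have [->|x0] := eqVneq x 0; first by rewrite bounded_map0 normr0.
have nx : `|x| != 0 by rewrite normr_eq0.
have : `|f (`|x|^-1 *: x)| <= opnorm f.
  by apply: opnorm_ub; rewrite normrZ normfV normr_id mulVf.
rewrite f0 bounded_mapZ normrZ normr_twist normfV normr_id.
by rewrite ler_pdivrMl ?normr_gt0// mulr0.
Qed.

HB.instance Definition _ :=
  Lmodule_isNormed.Build R[i] bounded_map opnormD opnormZ opnorm0_eq0.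

End BoundedOperators.

Section AntidualAndBoundedOperators.
Context (R : realType).
Implicit Types V W : normedModType R[i].

Definition bounded_op V W : Type := bounded_map false V W.
HB.instance Definition _ V W := NormedModule.on (bounded_op V W).

Definition antidual V : Type := bounded_map true V R[i]^o.
HB.instance Definition _ V := NormedModule.on (antidual V).

End AntidualAndBoundedOperators.

Section ClosedOperators.
Context (R : realType).
Implicit Types V W H : normedModType R[i].

Definition is_subspace V (D : set V) : Prop :=
  D 0 /\ forall (a : R[i]) (x y : V), D x -> D y -> D (a *: x + y).

Definition complemented H (X : set H) : Prop :=
  exists Y : set H, [/\ is_subspace Y, closed Y, X `&` Y = [set 0] &
    forall h, exists x y, [/\ X x, Y y & h = x + y]].

(* The values of [op_fun] outside [dom] are irrelevant: every notion below
   depends on a partial operator only through its graph. *)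
Record partial_op V W := PartialOp { dom : set V ; op_fun :> V -> W }.

Definition graph V W (T : partial_op V W) : set (V * W) :=
  [set p | dom T p.1 /\ p.2 = T p.1].

Definition closed_op V W (T : partial_op V W) : Prop :=
  [/\ is_subspace (dom T),
      forall (a : R[i]) (x y : V), dom T x -> dom T y ->
        T (a *: x + y) = a *: T x + T y
    & closed (graph T)].

Definition closed_com_op V W (T : partial_op V W) : Prop :=
  closed_op T /\ complemented (graph T).

Definition densely_defined V W (T : partial_op V W) : Prop := dense (dom T).

Definition adjoint_rel V W (T : partial_op V W) (f : antidual W)
    (g : antidual V) : Prop :=
  forall x, dom T x -> f (T x) = g x.

(* For densely defined [T] the functional [g] is unique, so the choice made by
   [xget] is immaterial. *)
Definition adjoint V W (T : partial_op V W) :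
    partial_op (antidual W) (antidual V) :=
  PartialOp [set f | exists g, adjoint_rel T f g]
            (fun f => xget 0 [set g | adjoint_rel T f g]).

(* [derivable Rz z0 1] is convergence in operator norm of the quotients
   h^-1 *: (Rz (z0 + h) - Rz z0) as h tends to 0 in R[i], h != 0.  The values
   of [Rz] outside the open neighbourhood [Theta0] of [z0] are irrelevant. *)
Definition complex_diff_subspaces H (Theta : set R[i]^o)
    (X : R[i]^o -> set H) (z0 : R[i]^o) : Prop :=
  exists Theta0 : set R[i]^o,
    [/\ open Theta0, Theta0 z0, Theta0 `<=` Theta &
     exists (K : completeNormedModType R[i]) (Rz : R[i]^o -> bounded_op K H),
       (forall z, Theta0 z ->
         [/\ injective (Rz z), closed (range (Rz z))
           & set_bij setT (X z) (Rz z)])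
       /\ derivable Rz z0 1].

Definition complex_diff_ops V W (Theta : set R[i]^o)
    (T : R[i]^o -> partial_op V W) (z0 : R[i]^o) : Prop :=
  complex_diff_subspaces Theta (fun z => graph (T z)) z0.

End ClosedOperators.

(* Main.v *)
Require Import Defs.
From HB Require Import structures.
From mathcomp Require Import all_boot all_order all_algebra.
From mathcomp Require Import all_classical all_reals all_analysis.
From mathcomp.real_closed Require Import complex.
From mathcomp Require Import ring lra.

(** The graph of [adjoint T] is the annihilator of the graph of [T] under the
    pairing [(f, g), (x, y) |-> f y - g x], so the theorem concerns a family [X]
    of closed subspaces of a Banach space and the family of annihilators.  Let
    [Y] be a closed complement of [X z0].  Differentiability of [X] at [z0]
    amounts to: near [z0], [Y] is a complement of [X z], and the projection
    [P z] onto [X z] along [Y] is differentiable in norm.  Taking adjoints,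
    [1 - (P z)^*] is the projection onto the annihilator of [X z] along that of
    [Y], and it is differentiable in [z^*] since taking adjoints is antilinear.
    Conversely, if the annihilators of [X z] and [Y] are complementary, then
    Hahn-Banach bounds [x] by [x + y] and shows that [X z + Y] is dense, hence
    everything; the projection [P z] so obtained is the preadjoint of a
    differentiable family, and its difference quotients are Cauchy in norm. *)

Set Implicit Arguments.
Unset Strict Implicit.
Unset Printing Implicit Defensive.

Import Order.TTheory GRing.Theory Num.Theory.
Import numFieldNormedType.Exports.

Local Open Scope classical_set_scope.
Local Open Scope ring_scope.

(** The parametrisations [Rz] of the definition do not dualise well: their domain [K] is arbitrary,
    and the adjoint of [Rz z] has the annihilator of [X z] as its kernel rather than as its range.
    Projections along a fixed [Y] act on one fixed space, and passing to [1 - P^*] exchanges kernel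
    and range. The converse is not the direct statement applied to the adjoints, because the bidual
    may be strictly larger than the space: neither the projections onto the annihilators nor their
    derivative is known in advance to be an adjoint. What replaces reflexivity is that the norm of
    [H] is computed by pairing with [H']. This turns a bound on functionals into a bound on vectors,
    and a weak estimate uniform on unit balls into a norm estimate, so that completeness of [H]
    produces the derivative. *)

Section RealNorm.
Context (R : realType).
Implicit Types (V W : normedModType R[i]) (a : R[i]).

(** Norms take values in [R[i]], whose order is only partial. The real-valued version gives access
    to suprema, infima and linear arithmetic. *)
Definition rnorm (V : normedZmodType R[i]) (x : V) : R := complex.Re `|x|.

Section NormedZmod.
Variable V : normedZmodType R[i].
Implicit Types x y : V.

Lemma rnormE x : `|x| = (rnorm x)%:C%C.
Proof. by rewrite RRe_real// ger0_real. Qed.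

Lemma rnorm_ge0 x : 0 <= rnorm x.
Proof. by rewrite -lecR -rnormE rmorph0. Qed.

Lemma rnorm0 : rnorm (0 : V) = 0.
Proof. by rewrite /rnorm normr0. Qed.

Lemma rnormN x : rnorm (- x) = rnorm x.
Proof. by rewrite /rnorm normrN. Qed.

Lemma rnormB x y : rnorm (x - y) = rnorm (y - x).
Proof. by rewrite -rnormN opprB. Qed.

Lemma rnormD x y : rnorm (x + y) <= rnorm x + rnorm y.
Proof. by rewrite -lecR rmorphD/= -!rnormE ler_normD. Qed.

Lemma rnorm_tri y x z : rnorm (x - z) <= rnorm (x - y) + rnorm (y - z).
Proof. by rewrite (le_trans _ (rnormD _ _))// addrA subrK. Qed.

Lemma rnorm_eq0 x : rnorm x = 0 -> x = 0.
Proof. by move=> x0; apply/eqP; rewrite -normr_eq0 rnormE x0. Qed.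

Lemma rnorm_le0 x : rnorm x <= 0 -> x = 0.
Proof. by move=> x0; apply: rnorm_eq0; apply/eqP; rewrite eq_le x0 rnorm_ge0. Qed.

Lemma rnorm_small x : (forall e : R, 0 < e -> rnorm x <= e) -> x = 0.
Proof.
move=> H; apply: rnorm_le0; apply/ler_addgt0Pl => e e0.
by rewrite addr0 H.
Qed.
End NormedZmod.

Lemma rnormZ V a (x : V) : rnorm (a *: x) = rnorm (a : R[i]) * rnorm x.
Proof. by apply: complexI; rewrite rmorphM/= -!rnormE normrZ. Qed.

Lemma rnormM a b : rnorm (a * b : R[i]) = rnorm (a : R[i]) * rnorm (b : R[i]).
Proof. by apply: complexI; rewrite rmorphM/= -!rnormE normrM. Qed.

Lemma rnormV a : rnorm (a^-1 : R[i]) = (rnorm (a : R[i]))^-1.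
Proof. by apply: complexI; rewrite fmorphV/= -!rnormE normfV. Qed.

Lemma rnorm_conj a : rnorm (a^* : R[i]) = rnorm (a : R[i]).
Proof. by rewrite /rnorm norm_conjC. Qed.

Lemma rnorm_twist anti a : rnorm (twist anti a : R[i]) = rnorm (a : R[i]).
Proof. by rewrite /rnorm normr_twist. Qed.

Lemma rnormC (t : R) : rnorm (t%:C%C : R[i]) = `|t|.
Proof. by rewrite /rnorm normc_def/= expr0n/= addr0 sqrtr_sqr. Qed.

Lemma gt0_complexE (e : R[i]) : 0 < e -> e = (complex.Re e)%:C%C /\ 0 < complex.Re e.
Proof.
move=> e0; have eE : e = (complex.Re e)%:C%C by rewrite RRe_real// gtr0_real.
by split=> //; rewrite -ltcR -eE.
Qed.

Lemma nbhs_rnormP V (x : V) (A : set V) :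
  nbhs x A <-> exists2 e : R, 0 < e & forall y, rnorm (y - x) < e -> A y.
Proof.
rewrite -nbhs_nbhs_norm; split=> [[e /= /gt0_complexE [eE e0] eA]|[e e0 eA]].
  exists (complex.Re e) => // y yx; apply: eA => /=.
  by rewrite eE distrC rnormE ltcR.
exists (e%:C%C) => /=; first by rewrite ltcR.
by move=> y /=; rewrite distrC rnormE ltcR => /eA.
Qed.

Lemma open_rnormP V (A : set V) :
  open A <-> forall x, A x ->
    exists2 e : R, 0 < e & forall y, rnorm (y - x) < e -> A y.
Proof.
rewrite openE; split=> H x Ax; first exact/nbhs_rnormP/H.
exact/nbhs_rnormP/H.
Qed.

Lemma closed_rnormP V (A : set V) :
  closed A <-> forall x,
    (forall e : R, 0 < e -> exists2 y, A y & rnorm (y - x) < e) -> A x.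
Proof.
split=> [cA x H|H x clx].
  apply: cA => B /nbhs_rnormP[e e0 eB].
  by have [y Ay /eB By] := H _ e0; exists y.
apply: H => e e0.
have /clx [y [Ay yB]] : nbhs x [set y | rnorm (y - x) < e].
  by apply/nbhs_rnormP; exists e.
by exists y.
Qed.

(* The geometric rate makes the limit bound explicit, uniformly in any parameter. *)
Definition fast_complete V := forall (u : nat -> V) (C : R),
  (forall n, rnorm (u n.+1 - u n) <= C / 2 ^+ n) ->
  exists l, forall n, rnorm (u n - l) <= 2 * C / 2 ^+ n.

Lemma half_pow_small (C e : R) : 0 <= C -> 0 < e -> exists n, C / 2 ^+ n < e.
Proof.
move=> C0 e0; have := @cvg_geometric R C 2^-1.
have -> : `|2^-1 : R| < 1 by rewrite gtr0_norm ?invr_gt0// invf_lt1// ltr1n.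
move=> /(_ erefl) /cvgrPdist_lt /(_ _ e0) [n _ /(_ n (leqnn n))].
rewrite /geometric/= sub0r normrN exprVn => H; exists n.
exact: le_lt_trans (ler_norm _) H.
Qed.

(** The right-hand side is the exact geometric sum of the steps from [n] to [n + m]; keeping the
    subtracted tail is what lets the induction close. *)
Lemma fast_cauchy V (u : nat -> V) (C : R) :
  (forall n, rnorm (u n.+1 - u n) <= C / 2 ^+ n) ->
  forall n m, rnorm (u (n + m)%N - u n) <= 2 * C / 2 ^+ n - 2 * C / 2 ^+ (n + m).
Proof.
move=> uC n; elim=> [|m IH]; first by rewrite addn0 !subrr rnorm0.
rewrite addnS (le_trans (rnorm_tri (u (n + m)%N) _ _))//.
have := uC (n + m)%N; rewrite exprS.
set t := 2 ^+ (n + m); have t0 : t != 0 by rewrite expf_neq0.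
have -> : 2 * C / (2 * t) = C / t by field.
have := IH; rewrite -/t; set a := C / t.
have -> : 2 * C / t = 2 * a by rewrite /a; field.
lra.
Qed.

Lemma fast_cauchy_le V (u : nat -> V) (C : R) :
  (forall n, rnorm (u n.+1 - u n) <= C / 2 ^+ n) ->
  forall n m, rnorm (u (n + m)%N - u n) <= 2 * C / 2 ^+ n.
Proof.
move=> uC n m; apply: le_trans (fast_cauchy uC n m) _.
have C0 : 0 <= C.
  by have := le_trans (rnorm_ge0 _) (uC 0%N); rewrite expr0 divr1.
by rewrite gerBl divr_ge0// mulr_ge0.
Qed.

Lemma fast_complete_cnm (V : completeNormedModType R[i]) : fast_complete V.
Proof.
move=> u C uC.
have C0 : 0 <= C.
  by have := le_trans (rnorm_ge0 _) (uC 0%N); rewrite expr0 divr1.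
have : cvg (u @ \oo).
  apply: cauchy_cvg; apply: cauchy_exP => e /gt0_complexE[eE e0].
  have [n nC] := half_pow_small (mulr_ge0 (ler0n _ 2) C0) e0.
  exists (u n); exists n => // m /= nm; rewrite -ball_normE /ball_/=.
  rewrite distrC rnormE eE ltcR -(subnKC nm).
  exact: le_lt_trans (fast_cauchy_le uC _ _) nC.
move=> /cvg_ex[l ul]; exists l => n.
apply/ler_addgt0Pl => e e0.
have /(_ _) [|m _ mP] := (iffLR (cvgrPdist_lt _ _) ul) e%:C%C; first by rewrite ltcR.
have := mP (n + m)%N (leq_addl _ _); rewrite rnormE ltcR => lm.
rewrite (le_trans (rnorm_tri (u (n + m)%N) _ _))// addrC lerD//.
  by rewrite rnormB ltW.
by rewrite rnormB fast_cauchy_le.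
Qed.

(** The way back to filters, for the canonical instance on [bs_elt]: the parameter space in
    [complex_diff_subspaces] has to be a [completeNormedModType]. *)
Lemma fast_complete_cvg V : fast_complete V ->
  forall F : set_system V, ProperFilter F -> cauchy F -> cvg F.
Proof.
move=> Vc F FF /cauchyP Fc.
(* Two members of a proper filter meet, so consecutive centres are at distance at most 1/4 + 1/8 of
   [1 / 2 ^+ n]. *)
have /choice[u uF] : forall n : nat, exists x, F [set y | rnorm (y - x) < 4^-1 / 2 ^+ n].
  move=> n; have [|x Fx] := Fc (4^-1 / 2 ^+ n)%:C%C.
    by rewrite ltcR divr_gt0// ?invr_gt0// exprn_gt0.
  exists x; apply: filterS Fx => y; rewrite -ball_normE /ball_/=.
  by rewrite distrC rnormE ltcR.
have uC n : rnorm (u n.+1 - u n) <= 1 / 2 ^+ n.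
  have [y [/= y1 y2]] := filter_ex (filterI (uF n) (uF n.+1)).
  rewrite (le_trans (rnorm_tri y _ _))// [X in X + _]rnormB.
  move: y1 y2; rewrite exprS; set t := 2 ^+ n.
  have t0 : 0 < t by rewrite exprn_gt0.
  have -> : 4^-1 / (2 * t) = 8^-1 / t by field; rewrite gt_eqF.
  by have : 0 < t^-1 by [rewrite invr_gt0]; lra.
have [l ul] := Vc _ _ uC; apply/cvg_ex; exists l.
apply: (iffRL (cvgrPdist_lt _ _)) => e /gt0_complexE[eE e0].
have [n ne] := half_pow_small (ler0n R 4) e0.
apply: filterS (uF n) => y /= yu; rewrite distrC rnormE eE ltcR.
rewrite (le_lt_trans (rnorm_tri (u n) _ _))//.
move: (ul n) yu ne; set t := 2 ^+ n.
have : 0 < t^-1 by rewrite invr_gt0 exprn_gt0.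
lra.
Qed.
End RealNorm.

(** * Bounded maps and completeness *)

Lemma twist1 (R : realType) anti : twist anti (1 : R[i]) = 1.
Proof. by case: anti; rewrite /twist ?conjC1. Qed.

Lemma twistN (R : realType) anti (a : R[i]) : twist anti (- a) = - twist anti a.
Proof. by case: anti; rewrite /twist ?rmorphN. Qed.

Section BoundedMaps.
Context (R : realType) (anti : bool) (V W : normedModType R[i]).
Implicit Types (f g : bounded_map anti V W) (x y : V) (a : R[i]).

Lemma bounded_mapD f x y : f (x + y) = f x + f y.
Proof.
by have := bounded_map_semilinear f 1 x y; rewrite twist1 !scale1r.
Qed.

Lemma bounded_mapN f x : f (- x) = - f x.
Proof.
by apply/eqP; rewrite -addr_eq0 -bounded_mapD addNr bounded_map0.
Qed.

Lemma bounded_mapB f x y : f (x - y) = f x - f y.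
Proof. by rewrite bounded_mapD bounded_mapN. Qed.

Lemma rnorm_bounded_map f x : rnorm (f x) <= rnorm f * rnorm x.
Proof.
have [->|x0] := eqVneq x 0; first by rewrite bounded_map0 !rnorm0 mulr0.
have nx0 : `|x| != 0 by rewrite normr_eq0.
have : `|f (`|x|^-1 *: x)| <= opnorm f.
  by apply: opnorm_ub; rewrite normrZ normfV normr_id mulVf.
rewrite bounded_mapZ normrZ normr_twist normfV normr_id.
rewrite ler_pdivrMl ?normr_gt0// rnormE -[opnorm f]/(`|f|).
by rewrite (rnormE x) (rnormE f) -rmorphM lecR mulrC.
Qed.

Lemma rnorm_bounded_map_le f (C : R) : 0 <= C ->
  (forall x, rnorm (f x) <= C * rnorm x) -> rnorm f <= C.
Proof.
move=> C0 fC; rewrite -lecR -rnormE -[`|f|]/(opnorm f).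
apply: opnorm_le => x x1; rewrite rnormE lecR (le_trans (fC x))//.
by rewrite ler_piMr// -lecR -rnormE.
Qed.

Lemma bounded_semilinear (f : V -> W) (C : R) : Defs.semilinear anti f ->
  (forall x, rnorm (f x) <= C * rnorm x) -> f \in @bounded_map_pred R anti V W.
Proof.
move=> lf fC; apply/bounded_map_predP; split=> // x.
have fB y : f y - f x = f (y - x).
  have := lf (-1) x y; rewrite scaleN1r addrC => ->.
  by rewrite twistN twist1 scaleN1r addrC.
apply: (iffRL (cvgrPdist_lt _ _)) => e /gt0_complexE[eE e0].
apply/nbhs_rnormP; exists (complex.Re e / (`|C| + 1)).
  by rewrite divr_gt0// ltr_wpDl.
move=> y; rewrite ltr_pdivlMr ?ltr_wpDl// => yx.
rewrite distrC eE rnormE ltcR fB (le_lt_trans (fC _))//.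
apply: le_lt_trans yx; rewrite mulrC ler_wpM2l ?rnorm_ge0//.
by rewrite (le_trans (ler_norm _))// lerDl.
Qed.

(** The pointwise limits come with a rate proportional to [rnorm x], which is convergence in
    operator norm. *)
Lemma bounded_map_fast_complete : fast_complete W ->
  fast_complete (bounded_map anti V W).
Proof.
move=> Wc u C uC.
have C0 : 0 <= C.
  by have := le_trans (rnorm_ge0 _) (uC 0%N); rewrite expr0 divr1.
have /choice[l ul] : forall x, exists l, forall n,
    rnorm (u n x - l) <= 2 * (C * rnorm x) / 2 ^+ n.
  move=> x; apply: Wc => n.
  rewrite -[u n.+1 x - u n x]/((u n.+1 - u n) x).
  rewrite (le_trans (rnorm_bounded_map _ _))// mulrAC.
  by rewrite ler_wpM2r ?rnorm_ge0.
have ll : Defs.semilinear anti l.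
  move=> a x y; apply/eqP; rewrite -subr_eq0; apply/eqP.
  apply: rnorm_small => e e0.
  pose M := 2 * (C * rnorm (a *: x + y)) + rnorm a * (2 * (C * rnorm x)) + 2 * (C * rnorm y).
  have M0 : 0 <= M by rewrite /M !addr_ge0 ?mulr_ge0 ?rnorm_ge0.
  have [n /ltW] := half_pow_small M0 e0; apply: le_trans.
  have -> : l (a *: x + y) - (twist anti a *: l x + l y) =
    - (u n (a *: x + y) - l (a *: x + y)) + twist anti a *: (u n x - l x) + (u n y - l y).
    rewrite bounded_map_semilinear scalerBr opprB -[RHS]addrA.
    by rewrite (addrACA (_ *: u n x)) -opprD addrA subrK.
  rewrite (le_trans (rnormD _ _))// /M 2!mulrDl lerD//.
  rewrite (le_trans (rnormD _ _))// lerD//; first by rewrite rnormN.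
  by rewrite rnormZ rnorm_twist -mulrA ler_wpM2l ?rnorm_ge0.
have lC x : rnorm (l x) <= (2 * C + rnorm (u 0%N)) * rnorm x.
  rewrite -(subrK (u 0%N x) (l x)) (le_trans (rnormD _ _))// mulrDl lerD//.
    by rewrite rnormB (le_trans (ul x 0%N))// expr0 divr1 mulrA.
  exact: rnorm_bounded_map.
exists (BoundedMap (bounded_semilinear ll lC)) => n.
apply: rnorm_bounded_map_le => [|x]; first by rewrite divr_ge0 ?mulr_ge0.
by rewrite (le_trans (ul x n))// mulrA mulrAC.
Qed.

End BoundedMaps.

(** * Completeness of products and of the complex numbers *)

Section Products.
Context (R : realType).
Implicit Types V W : normedModType R[i].

Lemma rnorm_prod V W (p : V * W) : rnorm p = Num.max (rnorm p.1) (rnorm p.2).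
Proof.
apply: complexI; rewrite -rnormE prod_normE.
have [le|/ltW le] := leP (rnorm p.1) (rnorm p.2).
  by rewrite -rnormE; apply: max_r; rewrite !rnormE lecR.
by rewrite -rnormE; apply: max_l; rewrite !rnormE lecR.
Qed.

Lemma rnorm_fst V W (p : V * W) : rnorm p.1 <= rnorm p.
Proof. by rewrite rnorm_prod le_max lexx. Qed.

Lemma rnorm_snd V W (p : V * W) : rnorm p.2 <= rnorm p.
Proof. by rewrite rnorm_prod le_max lexx orbT. Qed.

Lemma prod_fast_complete V W : fast_complete V -> fast_complete W ->
  fast_complete (V * W)%type.
Proof.
move=> Vc Wc u C uC.
have [l1 ul1] := Vc (fun n => (u n).1) C (fun n => le_trans (rnorm_fst (u n.+1 - u n)) (uC n)).
have [l2 ul2] := Wc (fun n => (u n).2) C (fun n => le_trans (rnorm_snd (u n.+1 - u n)) (uC n)).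
by exists (l1, l2) => n; rewrite rnorm_prod ge_max/= ul1 ul2.
Qed.

(** Nested intervals: [v n] and [w n] are the ends of a decreasing sequence of intervals centred at
    [u n], and the supremum of the left ends lies in all of them. *)
Lemma realType_fast_complete (u : nat -> R) (C : R) :
  (forall n, `|u n.+1 - u n| <= C / 2 ^+ n) ->
  exists l, forall n, `|u n - l| <= 2 * C / 2 ^+ n.
Proof.
move=> uC; pose v n : R := u n - 2 * C / 2 ^+ n.
have C0 : 0 <= C.
  by have := le_trans (normr_ge0 _) (uC 0%N); rewrite expr0 divr1.
have t0 n : 0 < 2 ^+ n :> R by rewrite exprn_gt0.
have halfS n (c : R) : 2 * c / 2 ^+ n.+1 = c / 2 ^+ n.
  by rewrite exprS; field; rewrite gt_eqF.
have vS n m : v n <= v (n + m)%N.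
  elim: m => [|m]; first by rewrite addn0.
  move/le_trans; apply; rewrite addnS /v halfS.
  have := uC (n + m)%N; rewrite ler_norml -mulrA => /andP[H _]; lra.
pose w n : R := u n + 2 * C / 2 ^+ n.
have wS n m : w (n + m)%N <= w n.
  elim: m => [|m]; first by rewrite addn0.
  apply: le_trans; rewrite addnS /w halfS.
  have := uC (n + m)%N; rewrite ler_norml -mulrA => /andP[_ H]; lra.
have vw n m : v n <= w m.
  rewrite (le_trans (vS n m))// (le_trans _ (wS m n))// addnC /v /w.
  have : 0 <= 2 * C / 2 ^+ (m + n) by rewrite divr_ge0 ?mulr_ge0// ltW.
  lra.
have hs : has_sup (range v).
  by split; [exists (v 0%N), 0%N|exists (w 0%N) => _ [n _ <-]].
exists (sup (range v)) => n; rewrite distrC ler_distl; apply/andP; split.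
  by apply: ub_le_sup; [case: hs|exists n].
by apply: ge_sup; [case: hs|move=> _ [m _ <-]; exact: vw].
Qed.

Lemma rnorm_complex_le (z : R[i]) :
  rnorm z <= `|complex.Re z| + `|complex.Im z|.
Proof.
rewrite {1}[z]complexE (le_trans (rnormD _ _))// rnormM !rnormC lerD//.
by rewrite /rnorm normc_def/= expr0n expr1n/= add0r sqrtr1 mul1r.
Qed.

Lemma Re_le_rnorm (z : R[i]) : `|complex.Re z| <= rnorm z.
Proof. by rewrite -lecR -rnormE normc_ge_Re. Qed.

Lemma Im_le_rnorm (z : R[i]) : `|complex.Im z| <= rnorm z.
Proof.
rewrite /rnorm normc_def/= -(sqrtr_sqr (complex.Im z)) ler_wsqrtr//.
by rewrite lerDr sqr_ge0.
Qed.

Lemma complex_fast_complete : fast_complete (R[i]^o : normedModType R[i]).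
Proof.
move=> u C uC.
have [|a ua] := @realType_fast_complete (fun n => complex.Re (u n : R[i])) (C).
  move=> n; rewrite (le_trans _ (uC n))// (le_trans _ (Re_le_rnorm _))//.
  by case: (u n.+1) (u n) => ? ? [].
have [|b ub] := @realType_fast_complete (fun n => complex.Im (u n : R[i])) (C).
  move=> n; rewrite (le_trans _ (uC n))// (le_trans _ (Im_le_rnorm _))//.
  by case: (u n.+1) (u n) => ? ? [].
pose l : R[i] := Complex a b.
have ll n : rnorm ((u n : R[i]) - l) <= 2 * (2 * C) / 2 ^+ n.
  rewrite (le_trans (rnorm_complex_le _))//.
  have -> : 2 * (2 * C) / 2 ^+ n = 2 * C / 2 ^+ n + 2 * C / 2 ^+ n.
    by rewrite -mulrDl -mulr2n mulr_natl.
  move: (ua n) (ub n); case: (u n) => x y /= xa yb; exact: lerD.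
(* Adding the two coordinates loses a factor 2 in the rate. It only serves to identify the limit;
   the sharp rate comes from comparing [u n] with a far term [u (n + m)]. *)
exists (l : R[i]^o) => n; apply/ler_addgt0Pl => e e0.
have C0 : 0 <= C.
  by have := le_trans (rnorm_ge0 _) (uC 0%N); rewrite expr0 divr1.
have [m me] := half_pow_small (mulr_ge0 (ler0n R 4) C0) e0.
rewrite (le_trans (rnorm_tri (u (n + m)%N) _ _))// addrC lerD//.
  rewrite (le_trans (ll _))// (le_trans _ (ltW me))// mulrA -natrM.
  by rewrite ler_wpM2l ?mulr_ge0// lef_pV2 ?posrE ?exprn_gt0// ler_eXn2l ?ltr1n// leq_addl.
by rewrite rnormB fast_cauchy_le.
Qed.

End Products.

(** * Derivatives as norm estimates *)

Section Derivative.
Context (R : realType) (E : normedModType R[i]).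

(** Multiplying the difference quotient by [z - z0] removes the division and the exception at
    [z = z0]. *)
Lemma derivable_rnormP (f : R[i]^o -> E) (z0 : R[i]^o) :
  derivable f z0 1 <-> exists D : E, forall e : R, 0 < e ->
    exists2 d : R, 0 < d & forall z : R[i]^o, rnorm (z - z0) < d ->
      rnorm (f z - f z0 - ((z - z0) : R[i]) *: D) <= e * rnorm (z - z0).
Proof.
split=> [/cvg_ex[D fD]|[D fD]].
  exists D => e e0.
  have /(_ _) [|d /= /gt0_complexE[dE d0] dP] := (iffLR (cvgrPdist_le _ _) fD) e%:C%C.
    by rewrite ltcR.
  exists (complex.Re d) => // z zd; have [->|zz0] := eqVneq z z0.
    by rewrite !subrr scale0r subr0 !rnorm0 mulr0.
  have z0' : z - z0 != 0 :> R[i] by rewrite subr_eq0.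
  have /(_ _ _) := dP (z - z0); rewrite /ball_/= sub0r normrN rnormE dE ltcR => /(_ zd z0').
  rewrite [_%:A]mulr1 subrK rnormE lecR => H.
  have -> : f z - f z0 - ((z - z0) : R[i]) *: D =
      - (((z - z0) : R[i]) *: (D - (z - z0 : R[i])^-1 *: (f z - f z0))).
    by move: (f _ - f _) => X; rewrite scalerBr scalerA mulfV// scale1r opprB.
  by rewrite rnormN rnormZ mulrC ler_wpM2r// rnorm_ge0.
apply/cvg_ex; exists D; apply: (iffRL (cvgrPdist_le _ _)) => e /gt0_complexE[eE e0].
have [d d0 dP] := fD _ e0.
exists d%:C%C; first by rewrite /= ltcR.
move=> h; rewrite /ball_/= sub0r normrN rnormE ltcR => hd h0.
rewrite [_%:A]mulr1 eE rnormE lecR.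
have /(_ _) := dP (h + z0); rewrite addrK => /(_ hd) H.
have h0' : (h : R[i]) != 0 by [].
have -> : D - (h : R[i])^-1 *: (f (h + z0) - f z0) =
    - ((h : R[i])^-1 *: (f (h + z0) - f z0 - (h : R[i]) *: D)).
  by move: (f _ - f _) => X; rewrite scalerBr  scalerA mulVf// scale1r opprB.
rewrite rnormN rnormZ rnormV ler_pdivrMl 1?mulrC//.
by rewrite lt_neqAle rnorm_ge0 andbT eq_sym; apply: contra_neq h0' => /rnorm_eq0.
Qed.
End Derivative.

Section DerivativeOfMaps.
Context (R : realType) (V W : normedModType R[i]).

Lemma derivable_opP (f : R[i]^o -> bounded_op V W) (z0 : R[i]^o) :
  derivable f z0 1 <-> exists D : bounded_op V W, forall e : R, 0 < e ->
    exists2 d : R, 0 < d & forall z : R[i]^o, rnorm (z - z0) < d -> forall x,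
      rnorm (f z x - f z0 x - ((z - z0) : R[i]) *: D x)
        <= e * rnorm (z - z0) * rnorm x.
Proof.
rewrite derivable_rnormP; split=> -[D fD]; exists D => e e0;
  have [d d0 dP] := fD _ e0; exists d => // z zd.
  move=> x; rewrite -[X in rnorm X <= _]/((f z - f z0 - ((z - z0) : R[i]) *: D) x).
  by rewrite (le_trans (rnorm_bounded_map _ _))// ler_wpM2r ?rnorm_ge0// dP.
apply: rnorm_bounded_map_le; first by rewrite mulr_ge0 ?rnorm_ge0// ltW.
exact: dP.
Qed.
End DerivativeOfMaps.

(** * The Hahn-Banach theorem for complex seminorms *)

Section HahnBanach.
Context (R : realType) (V : lmodType R[i]).
Implicit Types (x y : V) (t : R) (p q : V -> R).

Definition sublinear q :=
  (forall x y, q (x + y) <= q x + q y) /\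
  (forall t x, 0 <= t -> q (t%:C%C *: x) = t * q x).

Lemma sublinear_intro q : q 0 = 0 -> (forall x y, q (x + y) <= q x + q y) ->
  (forall t x, 0 < t -> q (t%:C%C *: x) <= t * q x) -> sublinear q.
Proof.
move=> q0 qD qZ; split=> // t x; rewrite le_eqVlt => /predU1P[<-|t0].
  by rewrite rmorph0 scale0r mul0r.
apply/eqP; rewrite eq_le qZ//= -ler_pdivlMl//.
have := qZ t^-1 (t%:C%C *: x); rewrite invr_gt0 => /(_ t0).
rewrite scalerA -rmorphM/= mulVf ?gt_eqF//.
by rewrite rmorph1 scale1r.
Qed.

Lemma sublinear0 q : sublinear q -> q 0 = 0.
Proof. by case=> _ /(_ 0 0 (lexx _)); rewrite rmorph0 scale0r mul0r. Qed.

Lemma sublinearN q x : sublinear q -> - q (- x) <= q x.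
Proof.
move=> qs; have := qs.1 x (- x).
by rewrite subrr (sublinear0 qs); lra.
Qed.

(* The largest sublinear functional [g <= q] with [g (- x) = - q x] is the
   infimum of [q (y + t x) - t q x] over [t >= 0]. *)
Lemma sublinear_shift q x : sublinear q -> exists g,
  [/\ sublinear g, forall y, g y <= q y & forall y, g y <= q (y + x) - q x].
Proof.
move=> qs; have [qD qZ] := qs.
pose S y := [set q (y + t%:C%C *: x) - t * q x | t in [set t | 0 <= t]].
have Sinf y : has_inf (S y).
  split; first by exists (q (y + 0%:C%C *: x) - 0 * q x), 0 => /=.
  exists (- q (- y)) => _ [t /= t0 <-]; rewrite -qZ//.
  by have := qD (y + t%:C%C *: x) (- y); rewrite addrAC subrr add0r; lra.
pose g y := inf (S y).
have gle t y : 0 <= t -> g y <= q (y + t%:C%C *: x) - t * q x.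
  by move=> t0; apply: ge_inf; [case: (Sinf y)|exists t].
have geg y c : (forall t, 0 <= t -> c <= q (y + t%:C%C *: x) - t * q x) -> c <= g y.
  move=> H; apply: lb_le_inf; first by case: (Sinf y).
  by move=> _ [t /= t0 <-]; exact: H.
exists g; split.
- apply: sublinear_intro.
  + apply/eqP; rewrite eq_le; apply/andP; split.
      by have := gle 0 0 (lexx _); rewrite rmorph0 scale0r addr0 (sublinear0 qs) mul0r subr0.
    by apply: (geg) => t t0; rewrite add0r qZ// subrr.
  + move=> y z; rewrite -lerBlDr; apply: (geg) => t t0.
    rewrite lerBlDr -lerBlDl; apply: (geg) => s s0; rewrite lerBlDl.
    apply: le_trans (gle (t + s) (y + z) (addr_ge0 t0 s0)) _.
    rewrite rmorphD/= scalerDl addrACA mulrDl.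
    by have := qD (y + t%:C%C *: x) (z + s%:C%C *: x); lra.
  + move=> t y t0; rewrite -ler_pdivrMl//; apply: (geg) => s s0.
    rewrite ler_pdivrMl//.
    apply: le_trans (gle (t * s) (t%:C%C *: y) (mulr_ge0 (ltW t0) s0)) _.
    by rewrite rmorphM/= -scalerA -scalerDr (qZ _ _ (ltW t0)); lra.
- by move=> y; have := gle 0 y (lexx _); rewrite rmorph0 scale0r addr0 mul0r subr0.
- by move=> y; have := gle 1 y ler01; rewrite rmorph1 scale1r mul1r.
Qed.

(* A minimal sublinear functional is linear. *)
Lemma hahn_banach_real p : sublinear p -> exists f : V -> R,
  [/\ forall x y, f (x + y) = f x + f y,
      forall t x, f (t%:C%C *: x) = t * f x & forall x, f x <= p x].
Proof.
move=> ps.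
pose T := {q : V -> R | sublinear q /\ forall x, q x <= p x}.
(* The order is reversed, so that a maximal element for Zorn is a minimal functional. *)
pose le_T (q1 q2 : T) := `[< forall x, sval q2 x <= sval q1 x >].
have [||||[q [qs qp]] qmin] := @Zorn T le_T.
- by move=> t; apply/asboolP.
- move=> r s t /asboolP rs /asboolP st; apply/asboolP => x.
  exact: le_trans (st x) (rs x).
- move=> [s sP] [t tP] /asboolP/= st /asboolP/= ts.
  have E : s = t by apply/funext => x; apply/eqP; rewrite eq_le st ts.
  by case: _ / E tP {st ts} => tP; congr exist; exact: Prop_irrelevance.
- move=> A tA; have [[q0 Aq0]|A0] := pselect (exists q : T, A q); last first.
    by exists (exist _ p (conj ps (fun x => lexx _))) => s As; case: A0; exists s.
  pose S x : set R := [set sval q x | q in A].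
  have Sinf x : has_inf (S x).
    split; first by exists (sval q0 x), q0.
    exists (- p (- x)) => _ [[q [qs qp]] _ /= <-].
    by rewrite (le_trans _ (sublinearN x qs))// lerN2.
  pose m x := inf (S x).
  have mle (q : T) x : A q -> m x <= sval q x.
    by move=> Aq; apply: ge_inf; [case: (Sinf x)|exists q].
  have gem x c : (forall q : T, A q -> c <= sval q x) -> c <= m x.
    move=> H; apply: lb_le_inf; first by case: (Sinf x).
    by move=> _ [q Aq <-]; exact: H.
  have ms : sublinear m.
    apply: sublinear_intro.
    + apply/eqP; rewrite eq_le; apply/andP; split.
        by rewrite (le_trans (mle _ 0 Aq0))// (sublinear0 (proj1 (svalP q0))).
      by apply: (gem) => q Aq; rewrite (sublinear0 (proj1 (svalP q))).
    + move=> y z; rewrite -lerBlDr; apply: (gem) => q1 Aq1.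
      rewrite lerBlDr -lerBlDl; apply: (gem) => q2 Aq2; rewrite lerBlDl.
      (* The infimum of a chain is subadditive because the smaller of [q1] and [q2] can be used at
         both points. *)
      have [/asboolP qq|/asboolP qq] := tA _ _ Aq1 Aq2.
        rewrite (le_trans (mle _ _ Aq2))// (le_trans ((proj1 (svalP q2)).1 _ _))//.
        by rewrite lerD ?qq ?lexx.
      rewrite (le_trans (mle _ _ Aq1))// (le_trans ((proj1 (svalP q1)).1 _ _))//.
      by rewrite lerD ?qq ?lexx.
    + move=> t y t0; rewrite -ler_pdivrMl//; apply: (gem) => q Aq.
      by rewrite ler_pdivrMl// (le_trans (mle _ _ Aq))// (proj1 (svalP q)).2// ltW.
  have mp x : m x <= p x by exact: le_trans (mle _ _ Aq0) ((proj2 (svalP q0)) x).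
  by exists (exist _ m (conj ms mp)) => s As; apply/asboolP => x; exact: mle.
have [qD qZ] := qs.
have qD' x y : q (x + y) = q x + q y.
  apply/eqP; rewrite eq_le qD/=.
  (* Minimality forces [g = q], and the second bound on [g] then reads [q y + q x <= q (y + x)]. *)
  have [g [gs gq gx]] := sublinear_shift x qs.
  have gp z : g z <= p z by exact: le_trans (gq z) (qp z).
  have /(_ _) := qmin (exist _ g (conj gs gp)).
  have H : le_T (exist _ q (conj qs qp)) (exist _ g (conj gs gp)) by apply/asboolP.
  move=> /(_ H) /(congr1 sval)/= gE.
  by have := gx y; rewrite gE [y + x]addrC; lra.
have qN x : q (- x) = - q x.
  by apply/eqP; rewrite -addr_eq0 -qD' addNr (sublinear0 qs).
exists q; split=> // t x; have [t0|t0] := leP 0 t; first exact: qZ.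
have := qZ (- t) x; rewrite oppr_ge0 ltW// => /(_ erefl).
by rewrite rmorphN/= scaleNr qN mulNr => /oppr_inj.
Qed.

Lemma sqr_rnorm (w : R[i]) :
  rnorm w ^+ 2 = complex.Re w ^+ 2 + complex.Im w ^+ 2.
Proof. by rewrite /rnorm normc_def/= sqr_sqrtr// addr_ge0// sqr_ge0. Qed.

Lemma hahn_banach p x0 : (forall x y, p (x + y) <= p x + p y) ->
  (forall a x, p (a *: x) = rnorm (a : R[i]) * p x) ->
  exists f : V -> R[i],
  [/\ forall a x y, f (a *: x + y) = a^* * f x + f y,
      forall x, rnorm (f x) <= p x & f x0 = (p x0)%:C%C].
Proof.
move=> pD pZ.
have ps : sublinear p by split=> // t x t0; rewrite pZ rnormC ger0_norm.
have p_ge0 x : 0 <= p x.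
  have := pD x (- x); rewrite subrr (sublinear0 ps) -scaleN1r pZ.
  by rewrite rnormN /rnorm normr1/=; lra.
(* The shift at [x0] takes the place of prescribing the functional on the line through [x0]: any
   [f <= g] satisfies [f (- x0) <= p 0 - p x0], that is [p x0 <= f x0]. *)
have [g [gs gp gx0]] := sublinear_shift x0 ps.
have [f [fD fZ fg]] := hahn_banach_real gs.
have f0 : f 0 = 0 by have := fD 0 0; rewrite addr0; lra.
have fN x : f (- x) = - f x by apply/eqP; rewrite -addr_eq0 -fD addNr f0.
have fx0 : p x0 <= f x0.
  have := le_trans (fg (- x0)) (gx0 (- x0)).
  by rewrite fN addNr (sublinear0 ps); lra.
(* The imaginary part carries a plus sign, as opposed to the linear complexification, because [F] is
   to be antilinear. *)
pose F x : R[i] := Complex (f x) (f ('i%C *: x)).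
have FE (a : R[i]) x y : F (a *: x + y) = a^* * F x + F y.
  have faE (b : R[i]) z : f (b *: z) = complex.Re b * f z + complex.Im b * f ('i%C *: z).
    by rewrite {1}[b]complexE scalerDl fD fZ [_ * (_)%:C%C]mulrC -scalerA fZ.
  have -> : a^* = Complex (complex.Re a) (- complex.Im a) by case: (a).
  rewrite /F scalerDr !fD scalerA (faE a) (faE ('i%C * a)%R) {faE}; case: a => u v /=.
  by simpc; congr Complex; ring.
have Fp x : rnorm (F x) <= p x.
  have [->|Fx0] := eqVneq (F x) 0; first by rewrite rnorm0.
  (* The phase that makes [F (c *: x)] real and equal to the modulus of [F x], so that the bound on
     the real part applies. *)
  pose c : R[i] := F x / `|F x|.
  have nF0 : `|F x| != 0 by rewrite normr_eq0.
  have c1 : rnorm c = 1.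
    by rewrite /rnorm /c normrM normfV normr_id mulfV.
  have Fc : F (c *: x) = `|F x|.
    have := FE c x 0; rewrite addr0 => ->.
    have -> : F 0 = 0 by rewrite /F scaler0 f0.
    rewrite addr0 /c rmorphM fmorphV/= conj_normC mulrAC.
    by rewrite mulrC [_^* * _]mulrC -normCK expr2 mulKf.
  have := le_trans (fg (c *: x)) (gp _); rewrite pZ c1 mul1r; apply: le_trans.
  by rewrite -[f _]/(complex.Re (F (c *: x))) Fc.
exists F; split=> //.
have := Fp x0; have := sqr_rnorm (F x0); have := rnorm_ge0 (F x0).
rewrite /F /=; set r := rnorm _; set b := f (_ *: _) => r0 rE rp.
have ? := p_ge0 x0.
(* The modulus of [F x0] is at most [p x0] while its real part is at least [p x0], so the imaginary
   part vanishes. *)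
have fE : f x0 = p x0 by nra.
have b0 : b = 0 by nra.
by rewrite fE b0.
Qed.
End HahnBanach.

(** * Closed subspaces and the open mapping theorem *)

(* Identities between signed sums in an abelian group: each [- x] is cancelled
   against an [x] after both have been moved to the end of the sum. *)
Ltac zmod_last x := repeat progress rewrite [in LHS](addrAC _ x).
Ltac zmod_cancel := match goal with
  |- context [ - ?x ] => zmod_last (- x); zmod_last x; rewrite subrK end.
Ltac zmod := apply: subr0_eq; rewrite ?(opprD, opprB, opprK) ?addrA
  -[LHS]add0r ?addrA; repeat zmod_cancel; rewrite ?addr0.

Section Subspaces.
Context (R : realType) (H : normedModType R[i]) (Y : set H).
Hypothesis Ysub : is_subspace Y.

Lemma subspaceD x y : Y x -> Y y -> Y (x + y).
Proof. by move=> Yx Yy; rewrite -[x]scale1r; exact: Ysub.2. Qed.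

Lemma subspaceZ (a : R[i]) x : Y x -> Y (a *: x).
Proof. by move=> Yx; rewrite -[_ *: _]addr0; apply: Ysub.2 => //; exact: Ysub.1. Qed.

Lemma subspaceB x y : Y x -> Y y -> Y (x - y).
Proof. by move=> Yx Yy; apply: subspaceD => //; rewrite -scaleN1r; exact: subspaceZ. Qed.

End Subspaces.

Section BanachSubspace.
Context (R : realType).

(* Completeness of the ambient space is stored as a field, so that the type of
   the elements of the subspace is canonically a Banach space. *)
Record banach_subspace (H : normedModType R[i]) := BanachSubspace {
  bs_set :> set H ;
  bs_subspace : is_subspace bs_set ;
  bs_closed : closed bs_set ;
  bs_complete : fast_complete H }.

Context (H : normedModType R[i]) (X : banach_subspace H).

Definition bs_pred : {pred H} := [pred x | `[< bs_set X x >]].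

Record bs_elt := BsElt { bs_val : H ; bs_valP : bs_val \in bs_pred }.

HB.instance Definition _ := [isSub for bs_val].
HB.instance Definition _ := [Choice of bs_elt by <:].

Lemma bs_submod_closed : submod_closed bs_pred.
Proof.
split; first by apply/asboolP; exact: (bs_subspace X).1.
move=> a x y /asboolP Xx /asboolP Xy; apply/asboolP.
exact: (bs_subspace X).2.
Qed.

HB.instance Definition _ :=
  GRing.isSubmodClosed.Build R[i] H bs_pred bs_submod_closed.
HB.instance Definition _ := [SubChoice_isSubLmodule of bs_elt by <:].

Definition bs_norm (x : bs_elt) : R[i] := `|bs_val x|.

Lemma bs_normD x y : bs_norm (x + y) <= bs_norm x + bs_norm y.
Proof. exact: ler_normD. Qed.

Lemma bs_normZ (a : R[i]) x : bs_norm (a *: x) = `|a| * bs_norm x.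
Proof. exact: normrZ. Qed.

Lemma bs_norm0_eq0 x : bs_norm x = 0 -> x = 0.
Proof. by move=> /eqP; rewrite normr_eq0 => /eqP x0; exact: val_inj. Qed.

HB.instance Definition _ :=
  Lmodule_isNormed.Build R[i] bs_elt bs_normD bs_normZ bs_norm0_eq0.

Lemma bs_fast_complete : fast_complete bs_elt.
Proof.
move=> u C uC.
have C0 : 0 <= C.
  by have := le_trans (rnorm_ge0 _) (uC 0%N); rewrite expr0 divr1.
have [l ul] := bs_complete X (u := bs_val \o u) uC.
have Xl : l \in bs_pred.
  apply/asboolP; have /closed_rnormP clX := @bs_closed _ X; apply: clX => e e0.
  have [n ne] := half_pow_small (mulr_ge0 (ler0n R 2) C0) e0.
  exists (bs_val (u n)); first exact/asboolP/bs_valP.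
  exact: le_lt_trans (ul n) ne.
by exists (BsElt Xl) => n; exact: ul.
Qed.

HB.instance Definition _ :=
  Uniform_isComplete.Build bs_elt (fast_complete_cvg bs_fast_complete).

Lemma bs_set_val (x : bs_elt) : bs_set X (bs_val x).
Proof. exact/asboolP/bs_valP. Qed.

Lemma bs_mem x : bs_set X x -> x \in bs_pred.
Proof. by move=> Xx; exact/asboolP. Qed.

End BanachSubspace.

(** * Successive approximation, Baire category and the open mapping theorem *)

Section OpenMapping.
Context (R : realType).

(** Each correction halves the remainder, so the [k] components form a geometric series. The [Y]
    components are not summed: [h - Rk l] is a limit of elements of the closed [Y]. This one
    iteration serves for the open mapping theorem, for the stability of complements, and for passing
    from a dense sum to the whole space. *)
Lemma approx_surjective (K H : normedModType R[i]) (Rk : bounded_op K H)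
    (Y : set H) (C : R) : fast_complete K -> is_subspace Y -> closed Y -> 0 <= C ->
  (forall h, exists k y,
    [/\ Y y, rnorm k <= C * rnorm h & rnorm (h - Rk k - y) <= rnorm h / 2]) ->
  forall h, exists k y,
    [/\ Y y, rnorm k <= 2 * C * rnorm h & h = Rk k + y].
Proof.
move=> Kc Ys Yc C0 /choice[kf /choice[yf ky]] h.
pose r n := iter n (fun g => g - Rk (kf g) - yf g) h.
have rn n : rnorm (r n) <= rnorm h / 2 ^+ n.
  elim: n => [|n IH]; first by rewrite expr0 divr1.
  have [_ _] := ky (r n); rewrite -[_ - _ - _]/(r n.+1) => /le_trans; apply.
  by rewrite exprSr invfM mulrA ler_wpM2r.
pose s n := \sum_(i < n) kf (r i).
have sC n : rnorm (s n.+1 - s n) <= (C * rnorm h) / 2 ^+ n.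
  rewrite /s big_ord_recr. rewrite addrC addKr.
  have [_ /le_trans + _] := ky (r n); apply.
  by rewrite -mulrA ler_wpM2l.
have [l ul] := Kc _ _ sC; exists l, (h - Rk l); split.
- move/closed_rnormP in Yc; apply: Yc => e e0.
  pose M := 2 * (C * rnorm h) * rnorm Rk + rnorm h.
  have M0 : 0 <= M by rewrite /M !(addr_ge0, mulr_ge0, rnorm_ge0).
  have [n ne] := half_pow_small M0 e0.
  exists (h - Rk (s n) - r n).
    elim: (n) => [|m IH].
      by rewrite /s big_ord0 bounded_map0 subr0 subrr; exact: Ys.1.
    have -> : h - Rk (s m.+1) - r m.+1 = (h - Rk (s m) - r m) + yf (r m).
      rewrite /s big_ord_recr bounded_mapD.
      by rewrite -[r m.+1]/(r m - Rk (kf (r m)) - yf (r m)); zmod.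
    by apply: (subspaceD Ys) => //; case: (ky (r m)).
  apply: le_lt_trans ne.
  have -> : h - Rk (s n) - r n - (h - Rk l) = - Rk (s n - l) - r n.
    by rewrite bounded_mapB; zmod.
  rewrite (le_trans (rnormD _ _))// !rnormN /M mulrDl lerD//.
  rewrite (le_trans (rnorm_bounded_map _ _))// mulrC mulrAC.
  by rewrite ler_wpM2r ?rnorm_ge0.
- by have := ul 0%N; rewrite /s big_ord0 sub0r rnormN expr0 divr1 mulrA.
- by rewrite addrC subrK.
Qed.

Lemma baire (H : normedModType R[i]) (F : nat -> set H) :
  fast_complete H -> (forall n, closed (F n)) -> (forall x, exists n, F n x) ->
  exists n x, exists2 r : R, 0 < r & forall y, rnorm (y - x) < r -> F n y.
Proof.
move=> Hc Fc Fcover; apply: contrapT => noball.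
(* A pair is a closed ball. Positivity of the radius is placed under the existential so that choice
   gives a total function, with an arbitrary value at degenerate balls. *)
have step (n : nat) (s : H * R) : exists s' : H * R, 0 < s.2 ->
    [/\ 0 < s'.2, s'.2 <= s.2 / 2, rnorm (s'.1 - s.1) <= s.2 / 2 &
      forall y, rnorm (y - s'.1) <= s'.2 -> ~ F n y].
  have [s0|s0] := ltP 0 s.2; last by exists s.
  have [y ys Fy] : exists2 y, rnorm (y - s.1) < s.2 / 2 & ~ F n y.
    apply: contrapT => H1; apply: noball; exists n, s.1, (s.2 / 2).
      by rewrite divr_gt0.
    by move=> y ys; apply: contrapT => Fy; apply: H1; exists y.
  have [e e0 eF] : exists2 e : R, 0 < e & forall z, rnorm (z - y) < e -> ~ F n z.
    apply: contrapT => H1; apply: Fy; have /closed_rnormP clF := Fc n; apply: clF => e e0.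
    apply: contrapT => H2; apply: H1; exists e => // z zy Fz.
    by apply: H2; exists z.
  exists (y, Num.min (e / 2) (s.2 / 2)) => _ /=; split.
  - by rewrite lt_min !divr_gt0.
  - by rewrite ge_min lexx orbT.
  - exact: ltW.
  - move=> z; rewrite le_min => /andP[ze _]; apply: eF.
    by rewrite (le_lt_trans ze)// ltr_pdivrMr// ltr_pMr// ltr1n.
have {step} /choice[g gP] : forall n : nat, exists g : H * R -> H * R, forall s, 0 < s.2 ->
    [/\ 0 < (g s).2, (g s).2 <= s.2 / 2, rnorm ((g s).1 - s.1) <= s.2 / 2 &
      forall y, rnorm (y - (g s).1) <= (g s).2 -> ~ F n y].
  by move=> n; have [g gP] := choice (step n); exists g.
pose s := fix s (n : nat) : H * R := if n is m.+1 then g m (s m) else (0, 1).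
have s0 n : 0 < (s n).2.
  by elim: n => [|n IH]; [rewrite /= ltr01|case: (gP n (s n) IH)].
have s2 n : (s n).2 <= 1 / 2 ^+ n.
  elim: n => [|n IH]; first by rewrite expr0 divr1.
  have [_ /le_trans + _ _] := gP n _ (s0 n); apply.
  by rewrite exprSr invfM mulrA ler_wpM2r.
have [l ul] : exists l, forall n, rnorm ((s n).1 - l) <= 2 * 1 / 2 ^+ n.
  apply: Hc => n; have [_ _ /le_trans + _] := gP n _ (s0 n); apply.
  by rewrite (le_trans _ (s2 n))// ler_piMr ?invf_le1 ?ler1n// ltW.
(* Distance of centres bounded by the difference of radii means that the closed balls are nested;
   hence the limit lies in all of them. *)
have sm n m : rnorm ((s (n + m)%N).1 - (s n).1) <= (s n).2 - (s (n + m)%N).2.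
  elim: m => [|m IH]; first by rewrite addn0 !subrr rnorm0.
  rewrite addnS (le_trans (rnorm_tri (s (n + m)%N).1 _ _))//.
  have [_ + + _] := gP (n + m)%N _ (s0 (n + m)%N).
  rewrite -[g _ _]/(s (n + m).+1); lra.
have ls n : rnorm (l - (s n).1) <= (s n).2.
  apply/ler_addgt0Pl => e e0.
  have [m me] := half_pow_small (ler0n R 2) e0.
  rewrite (le_trans (rnorm_tri (s (n + m)%N).1 _ _))// lerD//.
    rewrite rnormB (le_trans (ul _))// mulr1 (le_trans _ (ltW me))//.
    by rewrite ler_wpM2l// lef_pV2 ?posrE ?exprn_gt0// ler_eXn2l ?ltr1n// leq_addl.
  by have := sm n m; have := s0 (n + m)%N; lra.
have [n Fn] := Fcover l.
by have [_ _ _ /(_ l (ls n.+1))] := gP n _ (s0 n).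
Qed.

Lemma bounded_inverse (K H : normedModType R[i]) (Rk : bounded_op K H)
    (Y : set H) : fast_complete K -> fast_complete H -> is_subspace Y -> closed Y ->
  (forall h, exists k y, Y y /\ h = Rk k + y) ->
  exists2 C : R, 0 <= C & forall h, exists k y,
    [/\ Y y, rnorm k <= C * rnorm h & h = Rk k + y].
Proof.
move=> Kc Hc Ys Yc surj.
(* The closure of [Y] plus the image of the ball of radius [n]. *)
pose F n : set H := [set h | forall e : R, 0 < e -> exists k y,
  [/\ Y y, rnorm k <= n%:R & rnorm (h - Rk k - y) < e]].
have [n [x [r r0 rF]]] : exists n x, exists2 r : R, 0 < r & forall y, rnorm (y - x) < r -> F n y.
  apply: baire => // [n|x].
    apply/closed_rnormP => x Fx e e0.
    have e2 : 0 < e / 2 by rewrite divr_gt0.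
    have [y Fy yx] := Fx _ e2; have [k [z [Yz kn yk]]] := Fy _ e2.
    exists k, z; split=> //.
    have -> : x - Rk k - z = (y - Rk k - z) - (y - x).
      by zmod.
    by rewrite (le_lt_trans (rnormD _ _))// rnormN [ltRHS](splitr e) ltrD.
  have [k [y [Yy ->]]] := surj x.
  exists (Num.truncn (rnorm k)).+1 => e e0; exists k, y; split=> //.
    by rewrite ltW// truncnS_gt.
  by rewrite (addrC (Rk k)) addrK subrr rnorm0.
(* Approximants of [x + t h] and of [x] differ by at most [2 n] in [K]; dividing by
   [t = r / (2 |h|)] gives [4 n / r] times the norm of [h]. *)
pose C : R := 4 * n%:R / r.
have C0 : 0 <= C by rewrite divr_ge0 ?mulr_ge0// ltW.
exists (2 * C); first by rewrite mulr_ge0.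
apply: approx_surjective => // h.
have [->|h0] := eqVneq h 0.
  exists 0, 0; split; first exact: Ys.1.
    by rewrite !rnorm0 mulr0.
  by rewrite bounded_map0 !subr0 rnorm0 mul0r.
have hp : 0 < rnorm h.
  by rewrite lt_neqAle rnorm_ge0 andbT eq_sym; apply: contra_neq h0 => /rnorm_eq0.
pose t : R := r / (2 * rnorm h).
have t0 : 0 < t by rewrite divr_gt0 ?mulr_gt0.
pose tc : R[i] := t%:C%C.
have tc0 : tc != 0 by rewrite -(rmorph0 (real_complex R)) (inj_eq (@complexI _)) gt_eqF.
have rtc : rnorm tc = t by rewrite rnormC gtr0_norm.
(* Two errors of [r / 8] add up to half the norm of [t h], the halving that [approx_surjective] asks
   for. *)
have e0 : 0 < r / 8 by rewrite divr_gt0.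
have [|k1 [y1 [Yy1 k1n h1]]] := rF (x + tc *: h) _ _ e0.
  rewrite addrC addKr rnormZ rtc /t.
  have -> : r / (2 * rnorm h) * rnorm h = r / 2 by field; rewrite gt_eqF.
  by lra.
have [|k2 [y2 [Yy2 k2n h2]]] := rF x _ _ e0; first by rewrite subrr rnorm0.
exists (tc^-1 *: (k1 - k2)), (tc^-1 *: (y1 - y2)); split.
- exact/(subspaceZ Ys)/(subspaceB Ys).
- rewrite rnormZ rnormV rtc /t /C.
  have -> : (r / (2 * rnorm h))^-1 = 2 * rnorm h / r by field; rewrite !gt_eqF.
  have := rnormD k1 (- k2); rewrite rnormN => k12.
  have -> : 4 * n%:R / r * rnorm h = 2 * rnorm h / r * (2 * n%:R) by field; rewrite gt_eqF.
  apply: ler_wpM2l; last by lra.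
  by apply: divr_ge0; [rewrite mulr_ge0 ?rnorm_ge0|exact: ltW].
- have -> : h - Rk (tc^-1 *: (k1 - k2)) - tc^-1 *: (y1 - y2) =
     tc^-1 *: ((x + tc *: h - Rk k1 - y1) - (x - Rk k2 - y2)).
    rewrite bounded_mapZ /twist/= -[X in X - _ - _](scalerK tc0) -!scalerBr bounded_mapB.
    by congr (_ *: _); zmod.
  rewrite rnormZ rnormV rtc ler_pdivrMl//.
  have -> : t * (rnorm h / 2) = r / 4 by rewrite /t; field; rewrite gt_eqF.
  by rewrite (le_trans (rnormD _ _))// rnormN; lra.
Qed.

End OpenMapping.

(** * Differentiable families of subspaces and of projections *)

Section Composition.
Context (R : realType) (U V W : normedModType R[i]).
Variables (f : bounded_op V W) (g : bounded_op U V).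

Lemma bounded_comp_subproof : (f \o g : U -> W) \in @bounded_map_pred R false U W.
Proof.
apply: (@bounded_semilinear _ _ _ _ _ (rnorm f * rnorm g)) => [a x y|x] /=.
  by rewrite (bounded_map_semilinear g) (bounded_map_semilinear f).
rewrite (le_trans (rnorm_bounded_map f _))// -mulrA.
by rewrite ler_wpM2l ?rnorm_ge0// rnorm_bounded_map.
Qed.

Definition bounded_comp : bounded_op U W := BoundedMap bounded_comp_subproof.

End Composition.

Section Coordinates.
Context (R : realType) (K H : normedModType R[i]).

(** The coordinate [k] is unique, since only 0 is sent into [Y]; hence any choice of it is linear,
    and the bound makes it continuous. *)
Lemma bounded_coordinate (Rk : bounded_op K H) (Y : set H) (C : R) :
  is_subspace Y -> (forall k, Y (Rk k) -> k = 0) ->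
  (forall h, exists2 k, rnorm k <= C * rnorm h & Y (h - Rk k)) ->
  exists L : bounded_op H K, forall h, rnorm (L h) <= C * rnorm h /\ Y (h - Rk (L h)).
Proof.
move=> Ys Y0 H1.
have /choice[L LP] : forall h, exists k, rnorm k <= C * rnorm h /\ Y (h - Rk k).
  by move=> h; have [k ? ?] := H1 h; exists k.
have Ll : Defs.semilinear false L.
  move=> a x y; apply/eqP; rewrite -subr_eq0; apply/eqP; apply: Y0.
  have [_ Yx] := LP x; have [_ Yy] := LP y; have [_ Yxy] := LP (a *: x + y).
  have := subspaceB Ys (Ys.2 a _ _ Yx Yy) Yxy.
  rewrite bounded_mapB (bounded_map_semilinear Rk) scalerBr.
  by congr Y; zmod.
exists (BoundedMap (bounded_semilinear Ll (fun h => (LP h).1))) => h; exact: LP.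
Qed.

End Coordinates.

Section Projections.
Context (R : realType) (H : normedModType R[i]).
Implicit Types (X Y : set H) (P : H -> H).

(** Stated for bare functions so that it also applies to [f => f - Q f]. *)
Definition projection_along P X Y :=
  (forall h, X (P h) /\ Y (h - P h)) /\ forall h, X h -> Y h -> h = 0.

Lemma projection_id P X Y x : is_subspace X -> projection_along P X Y ->
  X x -> P x = x.
Proof.
move=> Xs [PXY XY0] Xx; have [XP YP] := PXY x.
by apply/eqP; rewrite eq_sym -subr_eq0; apply/eqP/XY0 => //; exact: subspaceB.
Qed.

Lemma projection_ker P X Y y : is_subspace Y -> projection_along P X Y ->
  Y y -> P y = 0.
Proof.
move=> Ys [PXY XY0] Yy; have [XP YP] := PXY y.
by apply: XY0 => //; rewrite -[P y](subKr y); exact: subspaceB.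
Qed.

Lemma bs_val_subproof (X : banach_subspace H) :
  (@bs_val R H X) \in @bounded_map_pred R false (bs_elt X) H.
Proof.
by apply: (@bounded_semilinear _ _ _ _ _ 1) => // x; rewrite mul1r.
Qed.

Definition bs_inclusion (X : banach_subspace H) : bounded_op (bs_elt X) H :=
  BoundedMap (bs_val_subproof X).

Lemma bounded_projection X Y (C : R) : fast_complete H ->
  is_subspace X -> closed X -> is_subspace Y ->
  (forall h, X h -> Y h -> h = 0) ->
  (forall h, exists x, [/\ X x, Y (h - x) & rnorm x <= C * rnorm h]) ->
  exists P : bounded_op H H,
    projection_along P X Y /\ forall h, rnorm (P h) <= C * rnorm h.
Proof.
move=> Hc Xs Xc Ys XY0 H1; pose B := BanachSubspace Xs Xc Hc.
have [|h|L LP] := @bounded_coordinate _ _ _ (bs_inclusion B) Y C Ys.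
- move=> k Yk; apply: val_inj; apply: XY0 => //; exact: (bs_set_val k).
- have [x [Xx Yx xC]] := H1 h.
  by exists (BsElt (bs_mem (X := B) Xx)).
- exists (bounded_comp (bs_inclusion B) L); split; last by move=> h; exact: (LP h).1.
  by split=> // h; split; [exact: (bs_set_val (L h))|exact: (LP h).2].
Qed.

Lemma complement_projection X Y : fast_complete H ->
  is_subspace X -> closed X -> is_subspace Y -> closed Y ->
  X `&` Y = [set 0] -> (forall h, exists x y, [/\ X x, Y y & h = x + y]) ->
  exists P : bounded_op H H, projection_along P X Y.
Proof.
move=> Hc Xs Xc Ys Yc XY0 XYH; pose B := BanachSubspace Xs Xc Hc.
have [|C C0 H1] := @bounded_inverse _ (bs_elt B) H (bs_inclusion B) Y
  (@bs_fast_complete _ _ B) Hc Ys Yc.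
- move=> h; have [x [y [Xx Yy ->]]] := XYH h.
  by exists (BsElt (bs_mem (X := B) Xx)), y.
have [|h|P [PXY _]] := @bounded_projection X Y C Hc Xs Xc Ys; last by exists P.
- by move=> h Xh Yh; have : (X `&` Y) h by []; rewrite XY0.
- have [k [y [Yy kC hE]]] := H1 h; exists (bs_val k); split=> //.
    exact: (bs_set_val k).
  by rewrite hE [_ + y]addrC addrK.
Qed.

Definition complex_diff_projections (Theta : set R[i]^o)
    (X : R[i]^o -> set H) (Y : set H) (z0 : R[i]^o) : Prop :=
  exists Theta0 : set R[i]^o,
    [/\ open Theta0, Theta0 z0, Theta0 `<=` Theta &
    exists P : R[i]^o -> bounded_op H H,
      (forall z, Theta0 z -> projection_along (P z) (X z) Y) /\ derivable P z0 1].

(** Take [K = X z0] and restrict [P z] to it. Since [X z] and [X z0] are complements of the same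
    [Y], this is a bijection onto [X z], with inverse the restriction of [P z0]. *)
Lemma complex_diff_of_projections (Theta : set R[i]^o) (X : R[i]^o -> set H)
    (Y : set H) (z0 : R[i]^o) : fast_complete H -> is_subspace Y ->
  (forall z, Theta z -> is_subspace (X z)) ->
  (forall z, Theta z -> closed (X z)) ->
  complex_diff_projections Theta X Y z0 -> complex_diff_subspaces Theta X z0.
Proof.
move=> Hc Ys Xs Xc [D0 [oT0 T0z0 T0T [P [PXY dP]]]].
exists D0; split=> //.
pose B := BanachSubspace (Xs _ (T0T _ T0z0)) (Xc _ (T0T _ T0z0)) Hc.
pose Rz (z : R[i]^o) := bounded_comp (P z) (bs_inclusion B).
exists (bs_elt B : completeNormedModType R[i]), Rz; split; last first.
  have /derivable_opP[D dD] := dP; apply/derivable_opP.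
  exists (bounded_comp D (bs_inclusion B)) => e e0.
  have [d d0 H1] := dD e e0; exists d => // z zd x; exact: H1.
move=> z T0z; have PXYz := PXY z T0z; have PXY0 := PXY z0 T0z0.
have inj : injective (Rz z).
  move=> x y xy; apply: val_inj; apply/eqP; rewrite -subr_eq0; apply/eqP.
  apply: PXY0.2; first by have := bs_set_val (x - y).
  have := (PXYz.1 (bs_val (x - y))).2.
  have -> : P z (bs_val (x - y)) = 0.
    rewrite -[LHS]/(Rz z (x - y)) (bounded_mapB (Rz z)) xy subrr//.
  by rewrite subr0.
have rng : range (Rz z) = X z.
  apply/seteqP; split=> [_ [k _ <-]|u Xu]; first exact: (PXYz.1 _).1.
  have [Xx Yx] := PXY0.1 u.
  exists (BsElt (bs_mem (X := B) Xx)) => //=.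
  rewrite -[RHS](projection_id (Xs _ (T0T _ T0z)) PXYz Xu).
  apply/eqP; rewrite eq_sym -subr_eq0 -bounded_mapB.
  by rewrite (projection_ker Ys PXYz).
split=> //; first by rewrite rng; exact/Xc/T0T.
split.
- by move=> k _; rewrite -rng; exists k.
- by move=> x y _ _; exact: inj.
- by move=> u Xu; rewrite -rng in Xu.
Qed.

(** By the open mapping theorem [Rz z0] is invertible modulo [Y], with a bound [C]. Near [z0] the
    operator [Rz z] is a small perturbation and stays injective and onto modulo [Y]; its coordinate
    map [L z] along [Y] yields [P z] as [Rz z] after [L z]. *)
Lemma complex_diff_to_projections (Theta : set R[i]^o) (X : R[i]^o -> set H)
    (Y : set H) (z0 : R[i]^o) : fast_complete H ->
  is_subspace Y -> closed Y -> X z0 `&` Y = [set 0] ->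
  (forall h, exists x y, [/\ X z0 x, Y y & h = x + y]) ->
  complex_diff_subspaces Theta X z0 -> complex_diff_projections Theta X Y z0.
Proof.
move=> Hc Ys Yc XY0 XYH [D0 [oT0 T0z0 T0T [K [Rz [RzX dRz]]]]].
have Kc : fast_complete K by exact: fast_complete_cnm.
have RX z k : D0 z -> X z (Rz z k).
  by move=> T0z; have [_ _ [/(_ k I)]] := RzX z T0z.
have XR z u : D0 z -> X z u -> exists k, Rz z k = u.
  by move=> T0z Xu; have [_ _ [_ _ /(_ u Xu)[k _ <-]]] := RzX z T0z; exists k.
have [C C0 H0] : exists2 C : R, 0 < C & forall h, exists k y,
    [/\ Y y, rnorm k <= C * rnorm h & h = Rz z0 k + y].
  have [|C C0 H0] := bounded_inverse (Rk := Rz z0) Kc Hc Ys Yc.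
    move=> h; have [x [y [Xx Yy ->]]] := XYH h.
    by have [k <-] := XR z0 x T0z0 Xx; exists k, y.
  exists (C + 1) => [|h]; first by rewrite ltr_wpDl.
  have [k [y [Yy kC hE]]] := H0 h; exists k, y; split=> //.
  by rewrite (le_trans kC)// ler_wpM2r ?rnorm_ge0// lerDl.
have inj0 k : Y (Rz z0 k) -> k = 0.
  move=> Yk; have : (X z0 `&` Y) (Rz z0 k) by split=> //; exact: RX.
  rewrite XY0 => k0; have [inj _ _] := RzX z0 T0z0.
  by apply: inj; rewrite k0 bounded_map0.
have /derivable_opP[D dD] := dRz.
(* A Lipschitz constant of [Rz] at [z0], read off from the derivative estimate with tolerance 1. *)
pose B := 1 + rnorm D.
have B0 : 0 < B by rewrite ltr_wpDr ?rnorm_ge0.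
have [d1 d10 H1] : exists2 d : R, 0 < d & forall z : R[i]^o, rnorm (z - z0) < d ->
    forall k, rnorm (Rz z k - Rz z0 k) <= B * rnorm (z - z0) * rnorm k.
  have [d d0 H1] := dD 1 ltr01; exists d => // z /H1 zd k.
  have := rnormD (Rz z k - Rz z0 k - ((z - z0) : R[i]) *: D k) (((z - z0) : R[i]) *: D k).
  rewrite subrK => /le_trans; apply; rewrite /B 2!mulrDl lerD//.
  rewrite rnormZ -mulrA mulrCA ler_wpM2l ?rnorm_ge0//.
  exact: rnorm_bounded_map.
have [d2 d20 H2] : exists2 d : R, 0 < d & forall z : R[i]^o, rnorm (z - z0) < d ->
    forall k, C * rnorm (Rz z k - Rz z0 k) <= rnorm k / 2.
  have CB0 : 0 < 2 * C * B by rewrite !mulr_gt0.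
  exists (Num.min d1 (2 * C * B)^-1) => [|z]; first by rewrite lt_min d10 invr_gt0.
  rewrite lt_min => /andP[/H1 zd1 zd] k.
  rewrite (le_trans (ler_wpM2l (ltW C0) (zd1 k)))// mulrA [leRHS]mulrC.
  rewrite ler_wpM2r ?rnorm_ge0//.
  have : rnorm (z - z0) * (2 * C * B) <= 1.
    by rewrite -ler_pdivlMr// mul1r; exact: ltW.
  lra.
have d2z0 : rnorm (z0 - z0) < d2 by rewrite subrr rnorm0.
have Rinj z : rnorm (z - z0) < d2 -> forall k, Y (Rz z k) -> k = 0.
  (* Modulo [Y] the difference equals [Rz z0 k], so its coordinate is [k] itself, and smallness of
     the difference gives [|k| <= |k| / 2]. *)
  move=> zd k Yk; have [k' [y [Yy k'C E]]] := H0 (Rz z0 k - Rz z k).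
  have kk' : k = k'.
    apply/eqP; rewrite -subr_eq0; apply/eqP/inj0.
    have -> : Rz z0 (k - k') = y + Rz z k.
      by rewrite bounded_mapB -[y](addKr (Rz z0 k')) -E; zmod.
    exact: subspaceD.
  apply: rnorm_le0; have := H2 _ zd k; have := rnorm_ge0 k.
  by rewrite rnormB; rewrite -kk' in k'C; lra.
have Rsurj z : rnorm (z - z0) < d2 ->
    forall h, exists2 k, rnorm k <= 2 * C * rnorm h & Y (h - Rz z k).
  move=> zd h.
  have [h'|k [y [Yy kC hE]]] := approx_surjective (Rk := Rz z) Kc Ys Yc (ltW C0) _ h.
    have [k [y [Yy kC hE]]] := H0 h'; exists k, y; split=> //.
    have -> : h' - Rz z k - y = - (Rz z k - Rz z0 k) by rewrite hE; zmod.
    rewrite rnormN -(ler_pM2l C0) (le_trans (H2 z zd k))// mulrA.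
    by rewrite ler_wpM2r.
  by exists k => //; rewrite hE [_ + y]addrC addrK.
have /choice[L LP] : forall z : R[i]^o, exists L : bounded_op H K, rnorm (z - z0) < d2 ->
    forall h, rnorm (L h) <= 2 * C * rnorm h /\ Y (h - Rz z (L h)).
  move=> z; have [zd|zd] := ltP (rnorm (z - z0)) d2; last by exists 0.
  by have [L LP] := bounded_coordinate Ys (Rinj z zd) (Rsurj z zd); exists L.
pose P (z : R[i]^o) : bounded_op H H := bounded_comp (Rz z) (L z).
exists (D0 `&` [set z | rnorm (z - z0) < d2]); split.
- apply: openI => //; apply/open_rnormP => z /= zd.
  exists (d2 - rnorm (z - z0)); first by rewrite subr_gt0.
  by move=> y yz; have := rnorm_tri z y z0; lra.
- by [].
- by move=> z [/T0T].
have PXY z : D0 z -> rnorm (z - z0) < d2 -> projection_along (P z) (X z) Y.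
  move=> D0z zd; split=> [h|h Xh Yh].
    by split; [exact: RX|exact: (LP z zd h).2].
  have [k kh] := XR z h D0z Xh; rewrite -kh in Yh *.
  by rewrite (Rinj z zd k Yh) bounded_map0.
exists P; split=> [z [/= D0z zd]|]; first exact: PXY.
have PXY0 := PXY z0 T0z0 d2z0.
have PY h : Y h -> P z0 h = 0 by exact: (projection_ker Ys PXY0).
have LY h : Y h -> L z0 h = 0.
  by move=> Yh; apply: inj0; rewrite -[Rz _ _]/(P z0 h) PY//; exact: Ys.1.
have LR k : L z0 (Rz z0 k) = k.
  apply/eqP; rewrite eq_sym -subr_eq0; apply/eqP/inj0.
  by rewrite bounded_mapB; exact: (LP z0 d2z0 _).2.
(* Exact formulas: the variations of [P] and [L] are expressed through the variation [v] of [Rz]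
   alone, because [h - P z h] lies in [Y], where [L z0] vanishes. *)
have PzE z h : rnorm (z - z0) < d2 ->
    let v := Rz z (L z h) - Rz z0 (L z h) in
    P z h - P z0 h = v - P z0 v /\ L z h - L z0 h = - L z0 v.
  move=> zd v; have E : L z0 (Rz z (L z h)) = L z0 h.
    apply/eqP; rewrite eq_sym -subr_eq0 -bounded_mapB.
    by apply/eqP/LY; exact: (LP z zd h).2.
  have Lv : L z0 v = L z0 h - L z h by rewrite /v bounded_mapB E LR.
  split; last by rewrite Lv opprB.
  rewrite -[P z0 v]/(Rz z0 (L z0 v)) Lv bounded_mapB /v.
  by rewrite -[P z h]/(Rz z (L z h)) -[P z0 h]/(Rz z0 (L z0 h)); zmod.
pose Q : bounded_op H H := bounded_comp D (L z0).
(* To first order [v] is [(z - z0) D (L z0 h)], and [PzE] applies [1 - P z0] to it. *)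
apply/derivable_opP; exists (Q - bounded_comp (P z0) Q) => e e0.
pose M := 1 + rnorm (P z0).
have M0 : 0 < M by rewrite ltr_wpDr ?rnorm_ge0.
have N1 v : rnorm (v - P z0 v) <= M * rnorm v.
  rewrite (le_trans (rnormD _ _))// rnormN mulrDl mul1r lerD2l.
  exact: rnorm_bounded_map.
(* Half of [e] pays for the differentiability of [Rz]; the radius [e / (2 * G)] below keeps the term
   quadratic in [z - z0], with coefficient [G], within the other half. *)
pose e' := e / (2 * (M * (2 * C))).
have MC0 : 0 < 2 * (M * (2 * C)) by rewrite !mulr_gt0.
have e'0 : 0 < e' by rewrite divr_gt0.
have [d3 d30 H3] := dD e' e'0.
pose G := M * (B * (2 * C * (B * (2 * C)))).
have G0 : 0 < G by rewrite !mulr_gt0.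
exists (Num.min (Num.min d1 d2) (Num.min d3 (e / (2 * G)))) => [|z].
  by rewrite !lt_min d10 d20 d30 divr_gt0// mulr_gt0.
rewrite !lt_min => /andP[/andP[zd1 zd2] /andP[zd3 zd4]] h.
have [PE LE] := PzE z h zd2.
pose v := Rz z (L z h) - Rz z0 (L z h).
pose w := v - ((z - z0) : R[i]) *: D (L z0 h).
have -> : P z h - P z0 h - ((z - z0) : R[i]) *: (Q - bounded_comp (P z0) Q) h = w - P z0 w.
  rewrite PE -/v.
  rewrite -[(Q - _) h]/(D (L z0 h) - P z0 (D (L z0 h))).
  by rewrite /w (bounded_mapB (P z0) v) (bounded_mapZ (P z0)) /twist scalerBr; zmod.
rewrite (le_trans (N1 w))//.
(* Replacing [L z0 h] by [L z h] costs [L z0 v], itself of order [z - z0]. *)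
have wE : w = (v - ((z - z0) : R[i]) *: D (L z h)) - ((z - z0) : R[i]) *: D (L z0 v).
  by rewrite -[L z0 v]opprK -LE bounded_mapN bounded_mapB scalerN scalerBr /w; zmod.
have rz := rnorm_ge0 (z - z0); have rh := rnorm_ge0 h.
set r := rnorm (z - z0) in rz zd1 zd2 zd3 zd4 *.
have Lzh : rnorm (L z h) <= 2 * C * rnorm h := (LP z zd2 h).1.
have w1 : rnorm (v - ((z - z0) : R[i]) *: D (L z h)) <= e' * r * (2 * C * rnorm h).
  rewrite (le_trans (H3 z zd3 (L z h)))// ler_wpM2l// mulr_ge0// ltW//.
have w2 : rnorm (((z - z0) : R[i]) *: D (L z0 v)) <=
    r * (B * (2 * C * (B * r * (2 * C * rnorm h)))).
  rewrite rnormZ ler_wpM2l// (le_trans (rnorm_bounded_map _ _))//.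
  have C20 : 0 <= 2 * C by rewrite mulr_ge0// ltW.
  have DB : rnorm D <= B by rewrite lerDr.
  apply: ler_pM => //; try exact: rnorm_ge0.
  rewrite (le_trans (LP z0 d2z0 v).1)// ler_wpM2l//.
  rewrite (le_trans (H1 z zd1 (L z h)))// ler_wpM2l// mulr_ge0// ltW//.
have : rnorm w <= e' * r * (2 * C * rnorm h) + r * (B * (2 * C * (B * r * (2 * C * rnorm h)))).
  by rewrite wE (le_trans (rnormD _ _))// rnormN lerD.
move/(ler_wpM2l (ltW M0))/le_trans; apply.
have -> : M * (e' * r * (2 * C * rnorm h) + r * (B * (2 * C * (B * r * (2 * C * rnorm h))))) =
    (e' * (2 * (M * (2 * C))) / 2 + G * r) * (r * rnorm h) by rewrite /G; field.
have -> : e' * (2 * (M * (2 * C))) = e by rewrite /e' mulfVK// gt_eqF.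
rewrite -mulrA ler_wpM2r ?mulr_ge0//.
have : r * (2 * G) <= e by rewrite -ler_pdivlMr ?mulr_gt0//; exact: ltW.
lra.
Qed.

End Projections.

(** * Annihilators *)

Section Distance.
Context (R : realType) (V : normedModType R[i]) (M : set V).
Hypothesis Ms : is_subspace M.

(** The distance to [M] is a seminorm below the norm, zero on [M] and at least [e] at [x0];
    Hahn-Banach is applied to it. *)
Lemma separating_functional (x0 : V) (e : R) : 0 < e ->
  (forall m, M m -> e <= rnorm (x0 - m)) ->
  exists f : V -> R[i],
    [/\ forall a x y, f (a *: x + y) = a^* * f x + f y,
        forall x, rnorm (f x) <= rnorm x,
        forall m, M m -> f m = 0 & f x0 != 0].
Proof.
move=> e0 eM.
pose S x : set R := [set rnorm (x - m) | m in M].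
have Sinf x : has_inf (S x).
  split; first by exists (rnorm (x - 0)), 0 => //; exact: Ms.1.
  by exists 0 => _ [m _ <-]; exact: rnorm_ge0.
pose p x := inf (S x).
have ple x m : M m -> p x <= rnorm (x - m).
  by move=> Mm; apply: ge_inf; [case: (Sinf x)|exists m].
have gep x c : (forall m, M m -> c <= rnorm (x - m)) -> c <= p x.
  move=> H; apply: lb_le_inf; first by case: (Sinf x).
  by move=> _ [m Mm <-]; exact: H.
have p0 m : M m -> p m = 0.
  move=> Mm; apply/eqP; rewrite eq_le; apply/andP; split.
    by have := ple m m Mm; rewrite subrr rnorm0.
  by apply: (gep) => m' _; exact: rnorm_ge0.
have pD x y : p (x + y) <= p x + p y.
  rewrite -lerBlDr; apply: (gep) => m Mm; rewrite lerBlDr -lerBlDl.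
  apply: (gep) => m' Mm'; rewrite lerBlDl.
  rewrite (le_trans (ple _ _ (subspaceD Ms Mm Mm')))//.
  by rewrite opprD addrACA rnormD.
have pZle (a : R[i]) x : a != 0 -> p (a *: x) <= rnorm a * p x.
  move=> a0; have ra : 0 < rnorm a.
    by rewrite lt_neqAle rnorm_ge0 andbT eq_sym; apply: contra_neq a0 => /rnorm_eq0.
  rewrite -ler_pdivrMl//; apply: (gep) => m Mm; rewrite ler_pdivrMl//.
  by rewrite -rnormZ scalerBr; apply: ple; exact: subspaceZ.
have pZ (a : R[i]) x : p (a *: x) = rnorm a * p x.
  have [->|a0] := eqVneq a 0; first by rewrite scale0r rnorm0 mul0r p0//; exact: Ms.1.
  have ra : 0 < rnorm a.
    by rewrite lt_neqAle rnorm_ge0 andbT eq_sym; apply: contra_neq a0 => /rnorm_eq0.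
  apply/eqP; rewrite eq_le pZle//= -ler_pdivlMl// -rnormV.
  by rewrite -[X in p X <= _](scalerK a0) pZle// invr_eq0.
have [f [fl fp fx0]] := hahn_banach x0 pD pZ.
exists f; split=> //.
- move=> x; rewrite (le_trans (fp x))//.
  by have := ple x 0 Ms.1; rewrite subr0.
- by move=> m Mm; apply: rnorm_le0; rewrite -(p0 _ Mm); exact: fp.
- rewrite fx0 -(rmorph0 (real_complex R)) (inj_eq (@complexI _)) gt_eqF//.
  by rewrite (lt_le_trans e0)//; exact: gep.
Qed.

End Distance.

Section Pairing.
Context (R : realType) (H H' : normedModType R[i]).
Implicit Types (f g : H') (h x y : H) (a : R[i]) (X Y : set H).

(** [H'] is an isomorphic copy of the antidual of [H]. *)
Record antidual_pairing (B : H' -> H -> R[i]) : Prop := AntidualPairing {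
  pairingDl : forall a f g h, B (a *: f + g) h = a * B f h + B g h ;
  pairingDr : forall a f x y, B f (a *: x + y) = a^* * B f x + B f y ;
  pairing_bound : exists2 c : R, 0 < c &
    forall f h, rnorm (B f h) <= c * rnorm f * rnorm h ;
  pairing_norm : forall f (M : R), 0 <= M ->
    (forall h, rnorm (B f h) <= M * rnorm h) -> rnorm f <= M ;
  pairing_repr : forall (phi : H -> R[i]) (M : R),
    (forall a x y, phi (a *: x + y) = a^* * phi x + phi y) ->
    (forall h, rnorm (phi h) <= M * rnorm h) -> exists f, B f = phi }.

Context (B : H' -> H -> R[i]) (PB : antidual_pairing B).

Definition annihilator X : set H' := [set f | forall x, X x -> B f x = 0].

Lemma pairing0l h : B 0 h = 0.
Proof.
have := pairingDl PB (-1) 0 0 h.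
by rewrite scaler0 addr0 mulN1r addNr.
Qed.

Lemma pairing0r f : B f 0 = 0.
Proof.
have := pairingDr PB (-1) f 0 0.
by rewrite scaler0 addr0 rmorphN1 mulN1r addNr.
Qed.

Lemma pairingZl a f h : B (a *: f) h = a * B f h.
Proof. by rewrite -[a *: f]addr0 (pairingDl PB) pairing0l addr0. Qed.

Lemma pairingZr a f h : B f (a *: h) = a^* * B f h.
Proof. by rewrite -[a *: h]addr0 (pairingDr PB) pairing0r addr0. Qed.

Lemma pairingBl f g h : B (f - g) h = B f h - B g h.
Proof. by rewrite addrC -scaleN1r (pairingDl PB) mulN1r addrC. Qed.

Lemma pairingBr f x y : B f (x - y) = B f x - B f y.
Proof. by rewrite addrC -scaleN1r (pairingDr PB) rmorphN1 mulN1r addrC. Qed.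

Lemma pairingAr f x y : B f (x + y) = B f x + B f y.
Proof. by rewrite -[x]scale1r (pairingDr PB) rmorph1 mul1r scale1r. Qed.

Lemma pairing_eq0 f : (forall h, B f h = 0) -> f = 0.
Proof.
move=> Bf; apply: rnorm_le0; apply: (pairing_norm PB) => // h.
by rewrite Bf rnorm0 mul0r.
Qed.

Lemma pairing_norming h : exists f, rnorm f <= 1 /\ rnorm (B f h) = rnorm h.
Proof.
have [phi [phil phip phih]] :=
  hahn_banach h (@rnormD R H) (fun a x => rnormZ a x).
have [||f fphi] := pairing_repr PB (phi := phi) (M := 1) => //.
  by move=> x; rewrite mul1r.
exists f; split; last by rewrite fphi phih rnormC ger0_norm// rnorm_ge0.
by apply: (pairing_norm PB) => // x; rewrite fphi mul1r.
Qed.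

(** The device that brings estimates down from [H'] to [H]. *)
Lemma rnorm_le_pairing h (M : R) : 0 <= M ->
  (forall f, rnorm (B f h) <= M * rnorm f) -> rnorm h <= M.
Proof.
move=> M0 HM; have [f [f1 <-]] := pairing_norming h.
by rewrite (le_trans (HM f))// ler_piMr.
Qed.

Lemma annihilator_subspace X : is_subspace (annihilator X).
Proof.
split=> [x _|a f g fX gX x Xx]; first exact: pairing0l.
by rewrite (pairingDl PB) fX// gX// mulr0 addr0.
Qed.

Lemma annihilator_closed X : closed (annihilator X).
Proof.
have [c c0 Bc] := pairing_bound PB.
apply/closed_rnormP => f clf x Xx; apply: rnorm_small => e e0.
have cx : 0 < c * (rnorm x + 1) by rewrite mulr_gt0// ltr_wpDl ?rnorm_ge0.
have [g gX gf] := clf _ (divr_gt0 e0 cx).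
have -> : B f x = - B (g - f) x by rewrite pairingBl gX// sub0r opprK.
rewrite rnormN (le_trans (Bc _ _))//.
move: gf; rewrite ltr_pdivlMr// => /ltW; apply: le_trans.
have : 0 <= c * rnorm (g - f) by rewrite mulr_ge0 ?rnorm_ge0// ltW.
by lra.
Qed.

Lemma adjoint_map (P : bounded_op H H) :
  exists Q : bounded_op H' H', forall f h, B (Q f) h = B f (P h).
Proof.
have [c c0 Bc] := pairing_bound PB.
have BP f h : rnorm (B f (P h)) <= c * rnorm P * rnorm f * rnorm h.
  rewrite (le_trans (Bc _ _))//.
  rewrite [c * _ * rnorm f]mulrAC -[leRHS]mulrA.
  apply: ler_wpM2l; last exact: rnorm_bounded_map.
  by rewrite mulr_ge0 ?rnorm_ge0// ltW.
have /choice[Q QE] : forall f, exists g, forall h, B g h = B f (P h).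
  move=> f; have [|g gE] := pairing_repr PB (phi := fun h => B f (P h)) _ (BP f).
    by move=> a x y; rewrite (bounded_map_semilinear P) (pairingDr PB).
  by exists g => h; rewrite gE.
have Ql : Defs.semilinear false Q.
  move=> a f g; apply/eqP; rewrite -subr_eq0; apply/eqP/pairing_eq0 => h.
  by rewrite pairingBl (pairingDl PB) !QE (pairingDl PB) subrr.
have Qb f : rnorm (Q f) <= c * rnorm P * rnorm f.
  apply: (pairing_norm PB) => [|h]; last by rewrite QE.
  by rewrite !mulr_ge0 ?rnorm_ge0// ltW.
by exists (BoundedMap (bounded_semilinear Ql Qb)).
Qed.

Lemma adjoint_projection (P : bounded_op H H) (Q : H' -> H') X Y :
  is_subspace X -> is_subspace Y -> projection_along P X Y ->
  (forall f h, B (Q f) h = B f (P h)) ->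
  projection_along (fun f => f - Q f) (annihilator X) (annihilator Y).
Proof.
move=> Xs Ys PXY QE; split=> [f|f fX fY].
  split=> [x Xx|y Yy].
    by rewrite pairingBl QE (projection_id Xs PXY Xx) subrr.
  by rewrite subKr QE (projection_ker Ys PXY Yy) pairing0r.
apply: pairing_eq0 => h; have [XP YP] := PXY.1 h.
by rewrite -[h](subrK (P h)) pairingAr (fX _ XP) (fY _ YP) addr0.
Qed.

(** A functional separating a point from [X + Y] would lie in both annihilators. *)
Lemma annihilator_dense_sum X Y : is_subspace X -> is_subspace Y ->
  (forall f, annihilator X f -> annihilator Y f -> f = 0) ->
  forall h (e : R), 0 < e -> exists x y, [/\ X x, Y y & rnorm (h - x - y) < e].
Proof.
move=> Xs Ys XY0 h e e0; apply: contrapT => H1.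
pose M : set H := [set h | exists x y, [/\ X x, Y y & h = x + y]].
have Ms : is_subspace M.
  split; first by exists 0, 0; split; [exact: Xs.1|exact: Ys.1|rewrite addr0].
  move=> a _ _ [x [y [Xx Yy ->]]] [x' [y' [Xx' Yy' ->]]].
  exists (a *: x + x'), (a *: y + y'); split; [exact: Xs.2|exact: Ys.2|].
  by rewrite scalerDr addrACA.
have [m [x [y [Xx Yy ->]]]|phi [phil phib phiM phih]] :=
    separating_functional Ms (x0 := h) e0.
  rewrite leNgt; apply/negP => he; apply: H1; exists x, y; split=> //.
  by rewrite -addrA -opprD.
have [|f fE] := pairing_repr PB phil (M := 1); first by move=> x; rewrite mul1r.
have f0 : f = 0.
  apply: XY0 => [x Xx|y Yy]; rewrite fE; apply: phiM.
    by exists x, 0; split=> //; [exact: Ys.1|rewrite addr0].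
  by exists 0, y; split=> //; [exact: Xs.1|rewrite add0r].
by move/eqP: phih; rewrite -fE f0 pairing0l.
Qed.

Lemma preadjoint_projection (Q : bounded_op H' H') X Y : fast_complete H ->
  is_subspace X -> closed X -> is_subspace Y -> closed Y ->
  projection_along Q (annihilator X) (annihilator Y) ->
  exists P : bounded_op H H, projection_along P X Y /\
    forall f h, B f (P h) = B (f - Q f) h.
Proof.
move=> Hc Xs Xc Ys Yc [QXY XY0].
have [c c0 Bc] := pairing_bound PB.
pose C := c * (1 + rnorm Q).
have C0 : 0 < C by rewrite mulr_gt0// ltr_wpDr ?rnorm_ge0.
have QX f x : X x -> B f x = B (f - Q f) x.
  by move=> Xx; rewrite pairingBl (QXY f).1// subr0.
(* Choose [f] norming [x]. Then [f - Q f] agrees with [f] on [X] and vanishes on [Y], so its value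
   at [x + y] is that of [f] at [x]. *)
have bound x y : X x -> Y y -> rnorm x <= C * rnorm (x + y).
  move=> Xx Yy; have [f [f1 <-]] := pairing_norming x.
  have -> : B f x = B (f - Q f) (x + y).
    by rewrite QX// pairingAr ((QXY f).2 y Yy) addr0.
  rewrite (le_trans (Bc _ _))// ler_wpM2r ?rnorm_ge0// /C.
  apply: ler_wpM2l; first exact: ltW.
  rewrite (le_trans (rnormD _ _))// rnormN lerD//.
  by rewrite (le_trans (rnorm_bounded_map _ _))// ler_piMr// rnorm_ge0.
pose BX := BanachSubspace Xs Xc Hc.
have [|h|P [PXY _]] := @bounded_projection _ _ X Y (2 * (2 * C)) Hc Xs Xc Ys.
- move=> x Xx Yx; apply: rnorm_le0.
  have := bound x (- x) Xx; rewrite subrr rnorm0 mulr0; apply.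
  by rewrite -scaleN1r; exact: subspaceZ.
- have [|g|k [y [Yy kC hE]]] := approx_surjective (Rk := bs_inclusion BX)
    (@bs_fast_complete _ _ BX) Ys Yc _ _ h (C := 2 * C).
  + by rewrite mulr_ge0// ltW.
  + have [->|g0] := eqVneq g 0.
      exists 0, 0; split; first exact: Ys.1.
        by rewrite !rnorm0 mulr0.
      by rewrite bounded_map0 !subr0 rnorm0 mul0r.
    have rg : 0 < rnorm g.
      by rewrite lt_neqAle rnorm_ge0 andbT eq_sym; apply: contra_neq g0 => /rnorm_eq0.
    (* Within half the norm of [g], the sum [x + y] has norm at most twice that of [g]; this
       explains the constant [2 * C]. *)
    have [x [y [Xx Yy xy]]] := annihilator_dense_sum Xs Ys XY0 g (divr_gt0 rg (ltr0n _ 2)).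
    exists (BsElt (bs_mem (X := BX) Xx)), y; split=> //; last exact: ltW.
    have -> : 2 * C * rnorm g = C * (2 * rnorm g) by ring.
    apply: le_trans (bound x y Xx Yy) _; apply: ler_wpM2l; first exact: ltW.
    have := rnorm_tri g (x + y) 0; rewrite !subr0.
    have := rnorm_tri (x + y) g 0; rewrite !subr0 [rnorm (x + y - g)]rnormB opprD addrA.
    by move: xy; lra.
  + exists (bs_val k); split=> //; first exact: (bs_set_val k).
    by rewrite hE [_ + y]addrC addrK.
exists P; split=> // f h.
have [XP YP] := PXY.1 h.
rewrite QX//; apply/eqP; rewrite eq_sym -subr_eq0 -pairingBr.
by apply/eqP; rewrite (QXY f).2.
Qed.

End Pairing.

(** * Reflection of differentiable families of projections *)

Section Conjugation.
Context (R : realType).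

Lemma rnorm_conjB (w z : R[i]^o) :
  rnorm ((w^* : R[i]^o) - (z^* : R[i]^o)) = rnorm (w - z).
Proof. by rewrite -(rnorm_conj (w - z)) rmorphB. Qed.

Lemma open_conj (D : set R[i]^o) : open D -> open [set w : R[i]^o | D w^*].
Proof.
move=> /open_rnormP oD; apply/open_rnormP => w /= /oD[e e0 eD].
by exists e => // y yw; apply: eD; rewrite rnorm_conjB.
Qed.

Lemma bounded_id_subproof (V : normedModType R[i]) :
  (fun x : V => x) \in @bounded_map_pred R false V V.
Proof. by apply: (@bounded_semilinear _ _ _ _ _ 1) => // x; rewrite mul1r. Qed.

Definition bounded_id (V : normedModType R[i]) : bounded_op V V :=
  BoundedMap (bounded_id_subproof V).

End Conjugation.

Section Reflection.
Context (R : realType) (H H' : normedModType R[i]) (B : H' -> H -> R[i]).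
Hypothesis PB : antidual_pairing B.
Variables (Theta : set R[i]^o) (X : R[i]^o -> set H) (Y : set H) (z0 : R[i]^o).
Hypothesis Xs : forall z, Theta z -> is_subspace (X z).
Hypothesis Ys : is_subspace Y.

Lemma complex_diff_annihilator :
  complex_diff_projections Theta X Y z0 ->
  complex_diff_projections [set w : R[i]^o | Theta w^*]
    (fun w : R[i]^o => annihilator B (X w^*)) (annihilator B Y) (z0^* : R[i]^o).
Proof.
move=> [U [oU Uz0 UT [P [PXY /derivable_opP[D dD]]]]].
exists [set w : R[i]^o | U w^*]; split.
- exact: open_conj.
- by rewrite /= conjCK.
- by move=> w /= /UT.
have /choice[Q QE] := fun z => adjoint_map PB (P z).
have [D' D'E] := adjoint_map PB D.
exists (fun w : R[i]^o => bounded_id H' - Q (w^* : R[i]^o)); split.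
  move=> w /= Uw; apply: (adjoint_projection PB (P := P w^*)) => //.
  + exact/Xs/UT.
  + exact: PXY.
have [c c0 Bc] := pairing_bound PB.
(* The reflection enters here: a scalar [z - z0] leaves the second slot of the pairing conjugated,
   as the increment of [w = z^*]. The sign comes from [1 - Q]. *)
apply/derivable_opP; exists (- D') => e e0.
have [d d0 H1] := dD _ (divr_gt0 e0 c0); exists d => // w wd f.
pose z : R[i]^o := w^*; have wE : w = z^* by rewrite /z conjCK.
have zd : rnorm (z - z0) < d by rewrite -rnorm_conjB -wE.
have zE : ((z - z0) : R[i])^* = w - (z0^* : R[i]^o).
  by rewrite rmorphB; congr (_ - _); exact: conjCK.
have r0 := rnorm_ge0 (w - (z0^* : R[i]^o)).
apply: (pairing_norm PB) => [|h].
  by rewrite !mulr_ge0 ?rnorm_ge0// ltW.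
rewrite conjCK -/z.
have -> : (bounded_id H' - Q z) f - (bounded_id H' - Q z0) f
      - ((w - (z0^* : R[i]^o)) : R[i]) *: (- D') f =
    ((w - (z0^* : R[i]^o)) : R[i]) *: D' f - (Q z f - Q z0 f).
  rewrite -[(_ - Q z) f]/(f - Q z f) -[(_ - Q z0) f]/(f - Q z0 f).
  by rewrite -[(- D') f]/(- D' f) scalerN; zmod.
have -> : B (((w - (z0^* : R[i]^o)) : R[i]) *: D' f - (Q z f - Q z0 f)) h =
    - B f (P z h - P z0 h - ((z - z0) : R[i]) *: D h).
  rewrite (pairingBl PB) (pairingZl PB) (pairingBl PB) !QE D'E !(pairingBr PB).
  by rewrite (pairingZr PB) zE; ring.
rewrite rnormN (le_trans (Bc _ _))//.
have := H1 z zd h; rewrite -(ler_pM2l c0).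
have -> : c * (e / c * rnorm (z - z0) * rnorm h) = e * rnorm (z - z0) * rnorm h.
  by field; rewrite gt_eqF.
rewrite -[rnorm (z - z0)]rnorm_conjB -wE => H2.
have := ler_wpM2l (rnorm_ge0 f) H2; lra.
Qed.

Hypotheses (Hc : fast_complete H) (Xc : forall z, Theta z -> closed (X z)).
Hypothesis Yc : closed Y.

Lemma complex_diff_preannihilator :
  complex_diff_projections [set w : R[i]^o | Theta w^*]
    (fun w : R[i]^o => annihilator B (X w^*)) (annihilator B Y) (z0^* : R[i]^o) ->
  complex_diff_projections Theta X Y z0.
Proof.
move=> [U [oU Uz0 UT [Q [QXY /derivable_opP[D' dD']]]]].
have oU' := open_conj oU.
exists [set z : R[i]^o | U z^*]; split => //.
  by move=> z /= /UT; rewrite /= conjCK.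
have /choice[P PP] : forall z : R[i]^o, exists P : bounded_op H H, U z^* ->
    projection_along P (X z) Y /\ forall f h, B f (P h) = B (f - Q (z^* : R[i]^o) f) h.
  move=> z; have [Uz|nUz] := pselect (U z^*); last by exists 0.
  have Tz : Theta z by have := UT _ Uz; rewrite /= conjCK.
  have := QXY _ Uz; rewrite conjCK => QXYz.
  have [P PP] := preadjoint_projection PB Hc (Xs Tz) (Xc Tz) Ys Yc QXYz.
  by exists P.
exists P; split=> [z /= Uz|]; first exact: (PP z Uz).1.
have [c c0 Bc] := pairing_bound PB.
have [d0 d00 H0] : exists2 d : R, 0 < d & forall z, rnorm (z - z0) < d -> U z^*.
  by have /open_rnormP := oU'; exact.
(* The difference quotients of [P] converge weakly, uniformly on the unit ball. *)
have weak (e : R) : 0 < e -> exists2 d : R, 0 < d & forall z : R[i]^o,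
    rnorm (z - z0) < d -> forall f h,
    rnorm (B f (P z h - P z0 h) + ((z - z0) : R[i])^* * B (D' f) h)
      <= c * e * rnorm (z - z0) * rnorm f * rnorm h.
  move=> e0; have [d1 d10 H1] := dD' e e0.
  exists (Num.min d0 d1) => [|z]; first by rewrite lt_min d00.
  rewrite lt_min => /andP[/H0 Uz zd1] f h.
  rewrite -rnorm_conjB in zd1.
  have {H1} := H1 _ zd1 f; rewrite rnorm_conjB => H1.
  have -> : B f (P z h - P z0 h) + ((z - z0) : R[i])^* * B (D' f) h =
     - B (Q (z^* : R[i]^o) f - Q (z0^* : R[i]^o) f -
       (((z^* : R[i]^o) - (z0^* : R[i]^o)) : R[i]) *: D' f) h.
    rewrite (pairingBr PB) (PP z Uz).2 (PP z0 Uz0).2 !(pairingBl PB) (pairingZl PB).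
    by rewrite rmorphB; ring.
  rewrite rnormN (le_trans (Bc _ _))// ler_wpM2r ?rnorm_ge0//.
  by have := ler_wpM2l (ltW c0) H1; lra.
have /choice[d dP] : forall n : nat, exists d : R, 0 < d /\ forall z : R[i]^o,
    rnorm (z - z0) < d -> forall f h,
    rnorm (B f (P z h - P z0 h) + ((z - z0) : R[i])^* * B (D' f) h)
      <= c * (1 / 2 ^+ n) * rnorm (z - z0) * rnorm f * rnorm h.
  move=> n; have [|d d1 d2] := weak (1 / 2 ^+ n); last by exists d.
  by rewrite divr_gt0// exprn_gt0.
(* Increments along which the weak estimate has rate [1 / 2 ^+ n], so that the quotients [u n]
   converge fast. *)
pose t n : R[i] := (d n / 2)%:C%C.
have rt n : rnorm (t n) = d n / 2.
  by rewrite rnormC gtr0_norm// divr_gt0//; case: (dP n).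
have t0 n : t n != 0.
  apply/eqP => tn; have := rt n; rewrite tn rnorm0 => /esym/eqP.
  by rewrite gt_eqF// divr_gt0//; case: (dP n).
pose u n : bounded_op H H := (t n)^-1 *: (P (z0 + t n) - P z0).
have uP n f h : rnorm (B f (u n h) + B (D' f) h) <= c / 2 ^+ n * rnorm f * rnorm h.
  have [dn0 /(_ (z0 + t n))] := dP n.
  rewrite addrAC subrr add0r rt => /(_ _ f h) H1.
  have {}H1 := H1 ltac:(by rewrite ltr_pdivrMr// ltr_pMr// ltr1n).
  rewrite -[u n h]/((t n)^-1 *: (P (z0 + t n) h - P z0 h)) (pairingZr PB).
  have tc0 : (t n)^* != 0 by rewrite conjC_eq0.
  rewrite -(ler_pM2l (_ : 0 < rnorm ((t n)^*))); last first.
    by rewrite rnorm_conj rt divr_gt0.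
  rewrite -rnormM mulrDr mulrA -rmorphM/= mulfV// rmorph1 mul1r.
  apply: le_trans H1 _; rewrite rnorm_conj rt.
  by rewrite le_eqVlt; apply/orP; left; apply/eqP; ring.
(* Both [u n] and [u n.+1] are weakly close to the preadjoint of [- D'], should it exist. Testing
   their difference against all [f] gives a norm bound, and the limit [D] shows that this preadjoint
   exists. *)
have [|D uD] := bounded_map_fast_complete Hc (u := u) (C := 2 * c).
  move=> n; have C0 : 0 <= 2 * c / 2 ^+ n by rewrite divr_ge0// mulr_ge0// ltW.
  apply: rnorm_bounded_map_le => // h; apply: (rnorm_le_pairing PB).
    by rewrite mulr_ge0 ?rnorm_ge0.
  move=> f; rewrite -[(u n.+1 - u n) h]/(u n.+1 h - u n h) (pairingBr PB).
  have -> : B f (u n.+1 h) - B f (u n h) =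
      (B f (u n.+1 h) + B (D' f) h) - (B f (u n h) + B (D' f) h).
    by ring.
  rewrite (le_trans (rnormD _ _))// rnormN (le_trans (lerD (uP _ _ _) (uP _ _ _)))//.
  have : 0 <= c / 2 ^+ n * rnorm f * rnorm h by rewrite !mulr_ge0 ?rnorm_ge0// ltW.
  have -> : c / 2 ^+ n.+1 = c / 2 ^+ n / 2 by rewrite exprSr invfM mulrA.
  have -> : 2 * c / 2 ^+ n * rnorm h * rnorm f = 2 * (c / 2 ^+ n * rnorm f * rnorm h) by ring.
  by lra.
have DE f h : B f (D h) = - B (D' f) h.
  apply/eqP; rewrite -addr_eq0; apply/eqP; apply: rnorm_small => e e0.
  pose M := c * rnorm f * rnorm h * (1 + 4 * c).
  have M0 : 0 <= M by rewrite /M !mulr_ge0 ?addr_ge0 ?mulr_ge0 ?rnorm_ge0 ?(ltW c0).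
  have [n /ltW] := half_pow_small M0 e0; apply: le_trans.
  have -> : B f (D h) + B (D' f) h = (B f (u n h) + B (D' f) h) - B f (u n h - D h).
    by rewrite (pairingBr PB); ring.
  rewrite (le_trans (rnormD _ _))// rnormN.
  have H1 := uP n f h.
  have H2 : rnorm (u n h - D h) <= 2 * (2 * c) / 2 ^+ n * rnorm h.
    rewrite -[u n h - D h]/((u n - D) h) (le_trans (rnorm_bounded_map _ _))//.
    by rewrite ler_wpM2r ?rnorm_ge0.
  have H3 := Bc f (u n h - D h).
  have cf : 0 <= c * rnorm f by rewrite mulr_ge0 ?rnorm_ge0// ltW.
  have H4 := ler_wpM2l cf H2.
  have := lerD H1 (le_trans H3 H4); move/le_trans; apply.
  by rewrite le_eqVlt; apply/orP; left; apply/eqP; rewrite /M; ring.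
(* With [- D'] identified as the adjoint of [D], the weak estimate becomes a norm estimate for all
   [z] near [z0], beyond the sequence [t]. *)
apply/derivable_opP; exists D => e e0.
have [d1 d10 H1] := weak _ (divr_gt0 e0 c0); exists d1 => // z zd h.
have rz := rnorm_ge0 (z - z0).
apply: (rnorm_le_pairing PB) => [|f]; first by rewrite !mulr_ge0 ?rnorm_ge0// ltW.
rewrite (pairingBr PB) (pairingZr PB) DE mulrN opprK.
rewrite (le_trans (H1 z zd f h))//.
have -> : c * (e / c) = e by field; rewrite gt_eqF.
by rewrite mulrAC.
Qed.

End Reflection.

(** * Graphs *)

Section Graphs.
Context (R : realType).

Lemma graph_subspaceP (V W : normedModType R[i]) (T : partial_op V W) :
  is_subspace (graph T) <-> is_subspace (dom T) /\
    forall (a : R[i]) x y, dom T x -> dom T y -> T (a *: x + y) = a *: T x + T y.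
Proof.
split=> [[[T0 _] TD]|[[T0 TD] Tl]].
  have H1 (a : R[i]) x y : dom T x -> dom T y ->
      dom T (a *: x + y) /\ a *: T x + T y = T (a *: x + y).
    by move=> Tx Ty; exact: (TD a (x, T x) (y, T y)).
  split; first by split=> // a x y Tx Ty; exact: (H1 a x y Tx Ty).1.
  by move=> a x y Tx Ty; rewrite (H1 a x y Tx Ty).2.
split.
  split=> //=; have := Tl (-1) 0 0 T0 T0.
  by rewrite scaler0 addr0 scaleN1r addNr.
move=> a [x x'] [y y'] [/= Tx ->] [/= Ty ->]; split=> /=; first exact: TD.
by rewrite Tl.
Qed.

Lemma complex_diff_subspaces_eq (H : normedModType R[i]) (Theta : set R[i]^o)
    (X X' : R[i]^o -> set H) (z0 : R[i]^o) :
  (forall z, Theta z -> X z = X' z) ->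
  complex_diff_subspaces Theta X z0 -> complex_diff_subspaces Theta X' z0.
Proof.
move=> XX' [U [oU Uz0 UT [K [Rz [RzX dRz]]]]].
exists U; split=> //; exists K, Rz; split=> // z Uz.
by rewrite -XX'; [exact: RzX|exact: UT].
Qed.

Lemma antidual_fast_complete (V : normedModType R[i]) : fast_complete (antidual V).
Proof. exact: bounded_map_fast_complete (@complex_fast_complete R). Qed.

Context (H1 H2 : normedModType R[i]).

(** The factors are crossed to match the graph of the adjoint, which lies in
    [antidual H2 * antidual H1]. *)
Definition graph_pairing (p : antidual H2 * antidual H1) (q : H1 * H2) : R[i] :=
  (p.1 q.2 : R[i]) - (p.2 q.1 : R[i]).

Lemma graph_pairingP : antidual_pairing graph_pairing.
Proof.
split.
- move=> a [f f'] [g g'] [x y]; rewrite /graph_pairing /=.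
  transitivity (a * (f y : R[i]) + g y - (a * (f' x : R[i]) + g' x) : R[i]) => //.
  by ring.
- move=> a [f f'] [x x'] [y y']; rewrite /graph_pairing /=.
  rewrite (bounded_map_semilinear f) (bounded_map_semilinear f').
  transitivity (a^* * (f x' : R[i]) + f y' - (a^* * (f' x : R[i]) + f' y) : R[i]) => //.
  by ring.
(* Both products carry the maximum norm and the pairing adds two evaluations, hence the constant
   2. *)
- exists 2 => // f h; rewrite (le_trans (rnormD _ _))// rnormN.
  have b (V : normedModType R[i]) (g : antidual V) x :
      rnorm (g x : R[i]) <= rnorm (g : bounded_map true V R[i]^o) * rnorm x.
    exact: (@rnorm_bounded_map _ _ _ _ g x).
  have b1 := le_trans (b _ f.1 h.2)
    (ler_pM (rnorm_ge0 _) (rnorm_ge0 _) (rnorm_fst f) (rnorm_snd h)).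
  have b2 := le_trans (b _ f.2 h.1)
    (ler_pM (rnorm_ge0 _) (rnorm_ge0 _) (rnorm_snd f) (rnorm_fst h)).
  by have := lerD b1 b2; lra.
- move=> [f g] M M0 fM; rewrite rnorm_prod ge_max/=; apply/andP; split.
    apply: rnorm_bounded_map_le => // y; have := fM (0, y).
    by rewrite /graph_pairing/= bounded_map0 subr0 rnorm_prod/= rnorm0 max_r ?rnorm_ge0.
  apply: rnorm_bounded_map_le => // x; have := fM (x, 0).
  by rewrite /graph_pairing/= bounded_map0 sub0r rnormN rnorm_prod/= rnorm0 max_l ?rnorm_ge0.
- move=> phi M phil phiM.
  have phi0 : phi 0 = 0.
    by have := phil (-1) 0 0; rewrite scaler0 addr0 rmorphN1 mulN1r addNr.
  have fl : Defs.semilinear true (fun y : H2 => phi (0, y) : R[i]^o).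
    move=> a x y; rewrite -[RHS]phil; congr phi.
    by rewrite -[RHS]/(a *: 0 + 0, a *: x + y) scaler0 addr0.
  have gl : Defs.semilinear true (fun x : H1 => - phi (x, 0) : R[i]^o).
    move=> a x y; rewrite -[RHS]/(a^* * (- phi (x, 0)) + - phi (y, 0)).
    rewrite mulrN -opprD -phil; congr (- phi _).
    by rewrite -[RHS]/(a *: x + y, a *: 0 + 0) scaler0 addr0.
  have fM y : rnorm (phi (0, y) : R[i]^o) <= M * rnorm y.
    by have := phiM (0, y); rewrite rnorm_prod/= rnorm0 max_r ?rnorm_ge0.
  have gM x : rnorm (- phi (x, 0) : R[i]^o) <= M * rnorm x.
    by rewrite rnormN; have := phiM (x, 0); rewrite rnorm_prod/= rnorm0 max_l ?rnorm_ge0.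
  exists (BoundedMap (bounded_semilinear fl fM), BoundedMap (bounded_semilinear gl gM)).
  apply/funext => -[x y]; rewrite /graph_pairing/= opprK addrC.
  have := phil 1 (x, 0) (0, y); rewrite rmorph1 mul1r scale1r => <-.
  by congr phi; rewrite -[LHS]/(x + 0, 0 + y) addr0 add0r.
Qed.

(** Annihilating the graph is [adjoint_rel] rewritten. Density makes the second component unique,
    hence equal to the value chosen by [xget]. *)
Lemma graph_adjoint (T : partial_op H1 H2) : densely_defined T ->
  graph (adjoint T) = annihilator graph_pairing (graph T).
Proof.
move=> Td; have uniq f g g' : adjoint_rel T f g -> adjoint_rel T f g' -> g = g'.
  move=> fg fg'; apply/eqP; rewrite -subr_eq0; apply/eqP.
  pose v : bounded_map true H1 R[i]^o := g - g'.
  rewrite -/v; apply: rnorm_le0; apply: rnorm_bounded_map_le => // x.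
  rewrite mul0r; suff -> : v x = 0 by rewrite rnorm0.
  apply: rnorm_small => e e0.
  have M0 : 0 < rnorm v + 1 by rewrite ltr_wpDl ?rnorm_ge0.
  have [||y [/= xy Ty]] := Td [set y | rnorm (y - x) < e / (rnorm v + 1)].
  - by exists x; rewrite /= subrr rnorm0 divr_gt0.
  - apply/open_rnormP => y /= yx.
    exists (e / (rnorm v + 1) - rnorm (y - x)); first by rewrite subr_gt0.
    by move=> y' y'y; have := rnorm_tri y y' x; lra.
  have gy : v y = 0.
    by rewrite -[LHS]/(g y - g' y) -(fg y Ty) -(fg' y Ty) subrr.
  have vx : v x = - v (y - x) :> R[i]^o by rewrite bounded_mapB gy sub0r opprK.
  rewrite -[X in rnorm X <= _]/(v x) vx.
  rewrite rnormN (le_trans (rnorm_bounded_map _ _))//.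
  move: xy; rewrite ltr_pdivlMr// => /ltW; apply: le_trans.
  by rewrite mulrC ler_wpM2l ?rnorm_ge0// lerDl.
apply/seteqP; split=> -[f g].
  move=> [/= [g0 fg0] gE] [x _] [/= Tx ->].
  rewrite /graph_pairing/= gE; case: xgetP => [g' _ fg'|/(_ g0)] //.
  by rewrite (fg' x Tx) subrr.
move=> fgT; have fg : adjoint_rel T f g.
  by move=> x Tx; apply/eqP; rewrite -subr_eq0; apply/eqP; exact: (fgT (x, T x)).
split=> /=; first by exists g.
by case: xgetP => [g' _ fg'|/(_ g)] //; exact: uniq fg fg'.
Qed.

End Graphs.

Theorem theorem3p42 (R : realType) (H1 H2 : completeNormedModType R[i])
    (Theta : set R[i]^o) (z0 : R[i]^o) (T : R[i]^o -> partial_op H1 H2) :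
  open Theta -> Theta z0 ->
  (forall z : R[i]^o, Theta z -> closed_com_op (T z)) ->
  (forall z : R[i]^o, Theta z -> densely_defined (T z)) ->
  (forall z : R[i]^o, Theta z^* -> closed_com_op (adjoint (T z^*))) /\
  (complex_diff_ops Theta T z0 <->
   complex_diff_ops [set z : R[i]^o | Theta z^*]
     (fun z : R[i]^o => adjoint (T z^*)) (z0^* : R[i]^o)).
Proof.
move=> oTheta Tz0 Tcom Tdense.
have Hc : fast_complete (H1 * H2)%type.
  by apply: prod_fast_complete; exact: fast_complete_cnm.
have Hc' : fast_complete (antidual H2 * antidual H1)%type.
  by apply: prod_fast_complete; exact: antidual_fast_complete.
pose B := @graph_pairing R H1 H2.
have PB : antidual_pairing B by exact: graph_pairingP.
have Gs z : Theta z -> is_subspace (graph (T z)).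
  by move=> /Tcom[[Ts Tl _] _]; apply/graph_subspaceP.
have Gc z : Theta z -> closed (graph (T z)) by move=> /Tcom[[]].
have adjE (z : R[i]^o) : Theta z -> graph (adjoint (T z)) = annihilator B (graph (T z)).
  by move=> /Tdense; exact: graph_adjoint.
(* Used at every [z] to show that the adjoints have complemented graphs, and at [z0] to make the
   annihilator of [Y] available as the fixed complement of the adjoint family. *)
have compl z Y : Theta z -> is_subspace Y -> closed Y ->
    graph (T z) `&` Y = [set 0] ->
    (forall h, exists x y, [/\ graph (T z) x, Y y & h = x + y]) ->
    annihilator B (graph (T z)) `&` annihilator B Y = [set 0] /\
    forall f, exists g g', [/\ annihilator B (graph (T z)) g, annihilator B Y g' & f = g + g'].
  move=> Tz Ys Yc XY0 XYH.
  have [P PXY] := complement_projection Hc (Gs z Tz) (Gc z Tz) Ys Yc XY0 XYH.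
  have [Q QE] := adjoint_map PB P.
  have [QXY QXY0] := adjoint_projection PB (Gs z Tz) Ys PXY QE.
  split=> [|f].
    apply/seteqP; split=> [f [fX fY]|_ ->]; first exact: QXY0.
    by split; exact: (annihilator_subspace PB _).1.
  exists (f - Q f), (Q f); split; first exact: (QXY f).1.
    by have := (QXY f).2; rewrite subKr.
  by rewrite subrK.
split=> [z Tz|].
  have [_ [Y [Ys Yc XY0 XYH]]] := Tcom _ Tz.
  have [A1 A2] := compl _ _ Tz Ys Yc XY0 XYH.
  have As : is_subspace (graph (adjoint (T z^*))).
    by rewrite adjE//; exact: annihilator_subspace.
  have /graph_subspaceP[Ds Dl] := As.
  split; first by split=> //; rewrite adjE//; exact: annihilator_closed.
  exists (annihilator B Y); rewrite adjE//; split=> //.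
  - exact: annihilator_subspace.
  - exact: annihilator_closed.
have [_ [Y [Ys Yc XY0 XYH]]] := Tcom _ Tz0.
have [A1 A2] := compl _ _ Tz0 Ys Yc XY0 XYH.
have Ys' := annihilator_subspace PB Y; have Yc' := annihilator_closed PB (X := Y).
split=> [dT|dT'].
  have dP := complex_diff_to_projections Hc Ys Yc XY0 XYH dT.
  have dQ := complex_diff_annihilator PB Gs Ys dP.
  apply: complex_diff_subspaces_eq (complex_diff_of_projections Hc' Ys' _ _ dQ).
  - by move=> z /= Tz; rewrite adjE.
  - by move=> z _; exact: annihilator_subspace.
  - by move=> z _; exact: annihilator_closed.
apply: (complex_diff_of_projections Hc Ys Gs Gc).
apply: (complex_diff_preannihilator PB Gs Ys Hc Gc Yc).
apply: (complex_diff_to_projections Hc' Ys' Yc').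
- by rewrite conjCK.
- by move=> f; rewrite conjCK; exact: A2.
- by apply: complex_diff_subspaces_eq dT' => z /= Tz; rewrite adjE.
Qed.
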